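(* Let $\mathfrak{g}$ be a symmetrizable Kac--Moody algebra over $\mathbb{C}$ with Cartan subalgebra $\mathfrak{h}$, root system $\Phi$ and set of simple roots $\Pi$. Let $\mathfrak{s}\subseteq\mathfrak{g}$ be a regular subalgebra (a Lie subalgebra normalized by $\mathfrak{h}$) such that $\mathfrak{h}\subseteq\mathfrak{s}$, and let $$T=\{\alpha\in\Phi \mid \mathfrak{s}\cap\mathfrak{g}_\alpha\neq\{0\}\}$$ be its associated closed subset of $\Phi$. Let $V$ be an irreducible integrable highest weight $\mathfrak{g}$-module. If $$\Pi\subseteq \operatorname{cl}_{\mathrm{re}}(T\cup(-T)),$$ then $$(\operatorname{End} V)^{\mathfrak{s}}=\mathbb{C}\operatorname{Id}_V .$$
   Context: **Kac--Moody algebra.** Let $A=(a_{ij})$ be an $\ell\times\ell$ generalized Cartan matrix ($a_{ii}=2$; $a_{ij}\in\mathbb{Z}_{\le 0}$ for $i\ne j$; $a_{ij}=0\Rightarrow a_{ji}=0$) that is symmetrizable: there is a diagonal matrix $D=\mathrm{diag}(d_i)$ with all $d_i>0$ such that $DA$ is symmetric. A realization of $A$ is a triple $(\mathfrak{h},\Pi,\Pi^\vee)$ with $\mathfrak{h}$ a complex vector space of dimension $2\ell-\operatorname{rank}(A)$, and $\Pi=\{\alpha_1,\dots,\alpha_\ell\}\subset\mathfrak{h}^*$, $\Pi^\vee=\{\alpha_1^\vee,\dots,\alpha_\ell^\vee\}\subset\mathfrak{h}$ linearly independent sets with $\alpha_j(\alpha_i^\vee)=a_{ij}$. The associated symmetrizable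 Kac--Moody algebra $\mathfrak{g}=\mathfrak{g}(A)$ is the complex Lie algebra generated by $\mathfrak{h}$ and $e_i,f_i$ ($1\le i\le\ell$) with relations $[h,h']=0$, $[e_i,f_j]=\delta_{ij}\alpha_i^\vee$, $[h,e_i]=\alpha_i(h)e_i$, $[h,f_i]=-\alpha_i(h)f_i$ for $h,h'\in\mathfrak{h}$, and $(\operatorname{ad}e_i)^{1-a_{ij}}e_j=0=(\operatorname{ad}f_i)^{1-a_{ij}}f_j$ for $i\neq j$. The elements of $\Pi$ are the simple roots. **Roots.** $\mathfrak{g}=\mathfrak{h}\oplus\bigoplus_{\alpha\in\Phi}\mathfrak{g}_\alpha$, where $\mathfrak{g}_\alpha=\{x\in\mathfrak{g}\mid [h,x]=\alpha(h)x\ \forall h\in\mathfrak{h}\}$ and $\Phi\subset\mathfrak{h}^*\setminus\{0\}$ is the root system. Let $(\cdot\mid\cdot)$ be the bilinear form on $\mathfrak{h}^*$ induced by a standard invariant symmetric bilinear form on $\mathfrak{g}$ (nondegenerate on $\mathfrak{h}$, with $(\alpha_i\mid\alpha_i)>0$ and $a_{ij}=2(\alpha_i\mid\alpha_j)/(\alpha_i\mid\alpha_i)$). The set of real roots is $\Phi_{\mathrm{re}}=\{\alpha\in\Phi\mid(\alpha\mid\alpha)>0\}$. **Closedness.** A subset $S\subseteq\Phi$ is closed if $\alpha,\beta\in S$ and $\alpha+\beta\in\Phi$ imply $\alpha+\beta\in S$. A subset $S\subseteq\Phi_{\mathrm{re}}$ is real closed if $\alpha,\beta\in S$ and $\alpha+\beta\in\Phi_{\mathrm{re}}$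 imply $\alpha+\beta\in S$. For $S\subseteq\Phi$, the real closure $\operatorname{cl}_{\mathrm{re}}(S)$ is the smallest real closed subset of $\Phi_{\mathrm{re}}$ containing $S\cap\Phi_{\mathrm{re}}$. **Regular subalgebras.** A Lie subalgebra $\mathfrak{s}\subseteq\mathfrak{g}$ is regular if $[\mathfrak{h},\mathfrak{s}]\subseteq\mathfrak{s}$; then $\mathfrak{s}=(\mathfrak{s}\cap\mathfrak{h})\oplus\bigoplus_{\alpha\in\Phi}(\mathfrak{s}\cap\mathfrak{g}_\alpha)$. **Modules.** A weight module is a $\mathfrak{g}$-module $V=\bigoplus_{\mu\in\mathfrak{h}^*}V_\mu$ with $V_\mu=\{v\mid hv=\mu(h)v\ \forall h\in\mathfrak{h}\}$. It is a highest weight module of highest weight $\lambda$ if there is a nonzero $v_\lambda\in V$ with $e_iv_\lambda=0$ for all $i$, $hv_\lambda=\lambda(h)v_\lambda$ for all $h\in\mathfrak{h}$, and $V=U(\mathfrak{g})v_\lambda$. It is integrable if all $e_i$ and $f_i$ act locally nilpotently on $V$. **Invariants.** $\operatorname{End}(V)$ is the space of all $\mathbb{C}$-linear endomorphisms of $V$, with $\mathfrak{g}$-action $x\cdot F=x\circ F-F\circ x$, and $(\operatorname{End}V)^{\mathfrak{s}}=\{F\in\operatorname{End}(V)\mid x\cdot F=0\ \text{for all }x\in\mathfrak{s}\}$. *)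

(* Defs.v *)
From HB Require Import structures.
From mathcomp Require Import all_boot all_order all_algebra.
From mathcomp Require Import complex.
From mathcomp Require Import boolp classical_sets reals.

Set Implicit Arguments.
Unset Strict Implicit.
Unset Printing Implicit Defensive.

Import Order.TTheory GRing.Theory Num.Theory.
Local Open Scope classical_set_scope.
Local Open Scope ring_scope.
Local Open Scope complex_scope.

HB.mixin Record Lmodule_isLieAlgebra (K : fieldType) L of GRing.Lmodule K L := {
  lie : L -> L -> L;
  lie_linearl : forall y, linear (lie^~ y);
  lie_linearr : forall x, linear (lie x);
  liexx : forall x, lie x x = 0;
  lie_jacobi : forall x y z,
    lie x (lie y z) + lie y (lie z x) + lie z (lie x y) = 0
}.

#[short(type="lieAlgType")]
HB.structure Definition LieAlgebra (K : fieldType) :=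
  {L of Lmodule_isLieAlgebra K L & GRing.Lmodule K L}.

Notation "[: x , y ]" := (lie x y) (at level 0, x at level 99, y at level 99,
  format "[: x ,  y ]") : ring_scope.

Notation dual h := ('Hom(h, (GRing.regular _))).

Section CartanMatrix.
Variables (R : realType) (l : nat) (A : 'M[int]_l).

Definition generalized_Cartan_matrix :=
  [/\ forall i, A i i = 2,
      forall i j, i != j -> A i j <= 0
    & forall i j, A i j = 0 -> A j i = 0].

Definition symmetrizable :=
  exists d : 'rV[R]_l, (forall i, 0 < d 0 i) /\
    let DA := diag_mx d *m map_mx intr A in DA^T = DA.

Definition realization (h : vectType R[i])
    (alpha : 'I_l -> dual h) (acheck : 'I_l -> h) :=
  [/\ \dim {: h} = (2 * l - \rank (map_mx intr A : 'M[R[i]]_l))%N,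
      free (codom alpha), free (codom acheck)
    & forall i j, alpha j (acheck i) = (A i j)%:~R].

End CartanMatrix.

Section KacMoody.
Variables (R : realType) (l : nat) (A : 'M[int]_l) (h : vectType R[i]).
Variables (alpha : 'I_l -> dual h) (acheck : 'I_l -> h).

(* The exponent 1 - a_ij of the Serre relations is positive for i != j, so it *)
(* is not changed by taking its absolute value.                               *)
Definition KM_relations (L : lieAlgType R[i])
    (iota : h -> L) (e f : 'I_l -> L) :=
  [/\ forall t t', [: iota t, iota t'] = 0,
      forall i j, [: e i, f j] = if i == j then iota (acheck i) else 0,
      forall t i, [: iota t, e i] = (alpha i t : R[i]) *: e i,
      forall t i, [: iota t, f i] = - (alpha i t : R[i]) *: f i
    & forall i j, i != j ->
        iter (absz (1 - A i j)%R) (lie (e i)) (e j) = 0 /\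
        iter (absz (1 - A i j)%R) (lie (f i)) (f j) = 0].

(* g, with the images iota, e, f of the generators, is the Lie algebra        *)
(* presented by h, e_i, f_i and the relations above: the generators satisfy   *)
(* them, and any other solution of them factors through a unique Lie algebra  *)
(* morphism.                                                                  *)
Definition KacMoody_algebra (g : lieAlgType R[i])
    (iota : {linear h -> g}) (e f : 'I_l -> g) :=
  KM_relations iota e f /\
  forall (L : lieAlgType R[i]) (iota' : {linear h -> L}) (e' f' : 'I_l -> L),
    KM_relations iota' e' f' ->
    let extension (phi : {linear g -> L}) :=
      [/\ forall x y, phi [: x, y] = [: phi x, phi y],
          forall t, phi (iota t) = iota' t,
          forall i, phi (e i) = e' i & forall i, phi (f i) = f' i] in
    exists2 phi, extension phi & forall psi, extension psi -> psi =1 phi.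

End KacMoody.

Section Roots.
Variables (R : realType) (h : vectType R[i]) (g : lieAlgType R[i]).
Variable iota : {linear h -> g}.
Implicit Types (a b : dual h) (S : set (dual h)).

Definition root_space a : set g :=
  [set x | forall t, [: iota t, x] = (a t : R[i]) *: x].

Definition roots : set (dual h) :=
  [set a | a != 0 /\ root_space a `&` [set~ 0] !=set0].

Section Form.
Variable B : {symmetric g}.

(* t |-> B(t, -), an isomorphism from h to its dual when B is nondegenerate   *)
(* on h; the form on the dual is then the transport of B along it.            *)
Definition form_to_dual : 'Hom(h, dual h) :=
  linfun (fun t => linfun (fun t' => B (iota t) (iota t') : R[i]^o)).

Lemma form_to_dualE t t' : form_to_dual t t' = B (iota t) (iota t').
Proof.
have in_lin u : linear (fun t' => B (iota u) (iota t') : R[i]^o).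
  by move=> c x y; rewrite linearP linearPr.
pose nu u := linfun (fun t' => B (iota u) (iota t') : R[i]^o).
have nuE u x : nu u x = B (iota u) (iota x).
  pose inl := GRing.isLinear.Build _ _ _ _ _ (in_lin u).
  pose phi : {linear h -> R[i]^o} := HB.pack (fun t' => B (iota u) (iota t') : R[i]^o) inl.
  exact: (lfunE phi).
have out_lin : linear nu.
  move=> c x y; apply/lfunP => z; rewrite add_lfunE scale_lfunE !nuE.
  by rewrite linearP linearPl.
pose onl := GRing.isLinear.Build _ _ _ _ _ out_lin.
pose phi : {linear h -> dual h} := HB.pack nu onl.
by rewrite [form_to_dual]/(linfun phi) lfunE nuE.
Qed.

Definition dual_form a b : R[i] :=
  B (iota ((form_to_dual^-1)%VF a)) (iota ((form_to_dual^-1)%VF b)).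

Definition standard_form (l : nat) (A : 'M[int]_l) (alpha : 'I_l -> dual h) :=
  [/\ forall x y z, B [: x, y] z = B x [: y, z],
      forall t, (forall t', B (iota t) (iota t') = 0) -> t = 0,
      forall i, 0 < dual_form (alpha i) (alpha i)
    & forall i j, (A i j)%:~R =
        2 * dual_form (alpha i) (alpha j) / dual_form (alpha i) (alpha i)].

(* In the order of R[i], 0 < z means that z is real and positive.             *)
Definition real_roots : set (dual h) :=
  [set a | roots a /\ 0 < dual_form a a].

Definition real_closed S :=
  S `<=` real_roots /\
  forall a b, S a -> S b -> real_roots (a + b) -> S (a + b).

Definition real_closure S : set (dual h) :=
  smallest real_closed (S `&` real_roots).

End Form.

Definition lie_subalgebra (s : set g) :=
  GRing.submod_closed [in s] /\ forall x y, s x -> s y -> s [: x, y].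

Definition regular_subalgebra (s : set g) :=
  lie_subalgebra s /\ forall t x, s x -> s [: iota t, x].

Definition roots_of (s : set g) : set (dual h) :=
  [set a | roots a /\ (s `&` root_space a) `&` [set~ 0] !=set0].

End Roots.

Section Modules.
Variables (R : realType) (l : nat) (h : vectType R[i]) (g : lieAlgType R[i]).
Variables (iota : {linear h -> g}) (e f : 'I_l -> g).
Variables (V : lmodType R[i]) (rho : {bilinear g -> V -> V}).

Definition lie_module :=
  forall x y v, rho [: x, y] v = rho x (rho y v) - rho y (rho x v).

Definition irreducible_module :=
  (exists v : V, v != 0) /\
  forall W : set V, GRing.submod_closed [in W] ->
    (forall x v, W v -> W (rho x v)) -> W = [set 0] \/ W = [set: V].

Definition weight_space (mu : dual h) : set V :=
  [set v | forall t, rho (iota t) v = (mu t : R[i]) *: v].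

(* V is the sum of its weight spaces, and the sum is direct.                  *)
Definition weight_module :=
  (forall v, exists n (mu : 'I_n -> dual h) (w : 'I_n -> V),
     (forall k, weight_space (mu k) (w k)) /\ v = \sum_k w k) /\
  (forall n (mu : 'I_n -> dual h) (w : 'I_n -> V), injective mu ->
     (forall k, weight_space (mu k) (w k)) -> \sum_k w k = 0 ->
     forall k, w k = 0).

(* U(g)v: as U(g) is spanned by the monomials x_1 ... x_k with x_i in g, its  *)
(* elements are the linear combinations of the x_1 (... (x_k v)).             *)
Definition enveloping_orbit (v : V) : set V :=
  [set u | exists n (c : 'I_n -> R[i]) (m : 'I_n -> seq g),
     u = \sum_k c k *: foldr rho v (m k)].

Definition highest_weight_module (lambda : dual h) :=
  weight_module /\
  exists v : V, [/\ v != 0, forall i, rho (e i) v = 0,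
    weight_space lambda v & enveloping_orbit v = [set: V]].

Definition locally_nilpotent (phi : V -> V) :=
  forall v, exists n, iter n phi v = 0.

Definition integrable_module :=
  forall i, locally_nilpotent (rho (e i)) /\ locally_nilpotent (rho (f i)).

Definition End_act (x : g) (F : {linear V -> V}) : V -> V :=
  fun v => rho x (F v) - F (rho x v).

Definition End_invariants (s : set g) : set {linear V -> V} :=
  [set F | forall x, s x -> forall v, End_act x F v = 0].

Definition scalar_endomorphisms : set {linear V -> V} :=
  [set F | exists c : R[i], forall v, F v = c *: v].

End Modules.

Arguments scalar_endomorphisms {R} V.

(* Main.v *)
(* F commutes with h, hence preserves weights.  If F commutes with a root vector of
   a real root b, then by sl2-theory on the integrable module V it also commutes
   with a root vector of -b.  Real roots are Weyl conjugate to simple roots, so their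
   root spaces are lines on which the invariant form pairs g_b and g_-b
   nondegenerately, and their root vectors act locally nilpotently on g and V.  If a,
   b and a + b are real roots, then sl2-theory on g gives [g_a, g_b] <> 0.  Hence the
   real roots b such that F commutes with g_b and g_-b form a real closed set; it
   contains the real roots of T and -T, so all simple roots.  Thus F commutes with g;
   it preserves the line V_lambda and is a scalar by irreducibility. *)

From HB Require Import structures.
Require Import Defs.
From mathcomp Require Import all_boot all_order all_algebra.
From mathcomp Require Import complex ring zify.
From mathcomp Require Import boolp classical_sets reals.

Set Implicit Arguments.
Unset Strict Implicit.
Unset Printing Implicit Defensive.

Import Order.TTheory GRing.Theory Num.Theory.
Local Open Scope classical_set_scope.
Local Open Scope ring_scope.
Local Open Scope complex_scope.

(** * sl2-theory *)

(** Neither g nor V need be finite-dimensional, so complete reducibility is replaced by local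
    nilpotency. The basic fact is that [f^n] is injective on vectors of weight n >= 0, with its
    mirror for [e]. For simple roots, local nilpotency comes from the Serre relations on g and from
    integrability on V. For other real roots it follows from finiteness of weight strings, a
    statement about weights alone that reflections transport. No Weyl group element is lifted to g
    or V: root spaces are moved by powers of ad [e_i] and ad [f_i]. As g is known only by its
    presentation, signs of roots, g_0 = h and the simple root spaces are all read off from brackets
    of generators that span g. Real roots are defined by positive norm, so their conjugacy to simple
    roots needs a descent on height. Membership of a in T only says that s meets g_a;
    one-dimensionality of g_a turns this into commutation of F with all of g_a. The inclusion of h
    in s supplies commutation with the Cartan element of each sl2-triple, without which commuting
    with [e] would say nothing about [f]. *)

Lemma linear_iter (K : pzRingType) (V : lmodType K) (e : {linear V -> V}) n :
  linear (iter n e).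
Proof. by elim: n => [|n IH] c u v //=; rewrite IH linearP. Qed.

HB.instance Definition _ (K : pzRingType) (V : lmodType K) (e : {linear V -> V}) n :=
  GRing.isLinear.Build K V V _ (iter n e) (linear_iter e n).

Section Sl2.
Variables (K : numFieldType) (V : lmodType K).

(** [H] is not assumed diagonalizable; the statements below concern its eigenvectors. Local
    nilpotency of both [e] and [f] stands in for finite dimension. *)
Definition sl2_triple (e f H : {linear V -> V}) :=
  [/\ forall v, e (f v) = f (e v) + H v,
      forall v, H (e v) = e (H v) + 2 *: e v,
      forall v, H (f v) = f (H v) - 2 *: f v,
      forall v, exists n, iter n e v = 0
    & forall v, exists n, iter n f v = 0].

Lemma sl2_triple_swap e f H : sl2_triple e f H -> sl2_triple f e (\- H).
Proof.
case=> ef He Hf ne nf; split=> // v /=.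
- by rewrite ef addrK.
- by rewrite Hf linearN opprB addrC.
- by rewrite He linearN opprD.
Qed.

Variables e f H : {linear V -> V}.
Hypothesis efH : sl2_triple e f H.
Implicit Types (u v w : V) (c : K) (n p : nat).

Lemma sl2_weight_e k v c :
  H v = c *: v -> H (iter k e v) = (c + (2 * k)%:R) *: iter k e v.
Proof.
case: efH => _ He _ _ _ Hv; elim: k => [|k IH] /=; first by rewrite addr0.
by rewrite He IH linearZ -scalerDl mulnS natrD; congr (_ *: _); ring.
Qed.

Lemma sl2_weight_f k v c :
  H v = c *: v -> H (iter k f v) = (c - (2 * k)%:R) *: iter k f v.
Proof.
case: efH => _ _ Hf _ _ Hv; elim: k => [|k IH] /=; first by rewrite subr0.
rewrite Hf IH linearZ -scalerBl mulnS natrD; congr (_ *: _); ring.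
Qed.

(** This is [[e, f^k] = k f^(k-1) (H - k + 1)] at a weight vector. For [k = 0] the coefficient
    vanishes, so the truncated [k.-1] is harmless. *)
Lemma sl2_e_iter_f k v c : H v = c *: v ->
  e (iter k f v) = iter k f (e v) + (k%:R * (c - k%:R + 1)) *: iter k.-1 f v.
Proof.
move=> Hv; case: (efH) => ef _ _ _ _.
elim: k => [|k IH] /=; first by rewrite mul0r scale0r addr0.
rewrite ef IH (sl2_weight_f _ Hv) linearD linearZ /= -addrA; congr (_ + _).
case: k {IH} => [|k] /=.
  by rewrite mul0r scale0r add0r; congr (_ *: _); ring.
by rewrite -scalerDl; congr (_ *: _); rewrite !natrM -!natr1; ring.
Qed.

(** Let [n.+1] be the least power of [f] killing [w]. Applying [e] to [f^(n+1) w = 0] leaves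
    [(n+1)(c - n) f^n w = 0] with [f^n w] nonzero. *)
Lemma sl2_highest_weight w c : w != 0 -> H w = c *: w -> e w = 0 ->
  exists2 n, c = n%:R & iter n.+1 f w = 0.
Proof.
move=> w0 Hw ew; case: (efH) => _ _ _ _ nf.
have ex : exists n, iter n f w == 0 by have [n ?] := nf w; exists n; apply/eqP.
have [[|n] /eqP fw min] := ex_minnP ex; first by case/eqP: w0.
exists n => //; have := sl2_e_iter_f n.+1 Hw.
rewrite fw ew !linear0 add0r => /esym/eqP; rewrite scaler_eq0 mulf_eq0 pnatr_eq0 /=.
have /negPf -> : iter n f w != 0.
  by apply/negP => /min; rewrite ltnn.
by rewrite orbF -natr1 opprD addrA subrK subr_eq0 => /eqP.
Qed.

(** The scalar is the product of the [m (n - m + 1)] for [k < m <= j + k]; the bound [j + k <= n]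
    keeps every factor nonzero. *)
Lemma sl2_e_iter_f_highest w n j k : H w = n%:R *: w -> e w = 0 ->
  (j + k <= n)%N ->
  exists2 d, d != 0 & iter j e (iter (j + k) f w) = d *: iter k f w.
Proof.
move=> Hw ew; elim: j => [|j IH] jk; first by exists 1; rewrite ?oner_eq0 ?scale1r.
have [|d d0 dE] := IH; first exact: ltnW.
exists ((j + k).+1%:R * (n%:R - (j + k).+1%:R + 1) * d).
  rewrite !mulf_neq0 ?pnatr_eq0 // -natr1 opprD addrA subrK subr_eq0.
  by rewrite eqr_nat neq_ltn [(_ + _ < n)%N]jk orbT.
rewrite iterSr addSn (sl2_e_iter_f _ Hw) ew linear0 add0r /= linearZ /= dE.
by rewrite scalerA.
Qed.

(** Moving [e] across powers of [f] shows [f^(n+p) (e^p v) = 0] for all [p]. If [e^p v] were the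
    last nonzero one, it would be a highest weight vector of weight [n + 2p], which [f^(n+p)] cannot
    kill. *)
Lemma sl2_iter_f_inj v n : H v = n%:R *: v -> iter n f v = 0 -> v = 0.
Proof.
move=> Hv fv; case: (efH) => _ _ _ ne _.
have fe p : iter (n + p) f (iter p e v) = 0.
  elim: p => [|p IH] /=; first by rewrite addn0.
  have := sl2_e_iter_f (n + p).+1 (sl2_weight_e p Hv).
  by rewrite /= IH !linear0 addr0 addnS.
have [p] := ne v; elim: p => [//|p IH] ep; apply: IH; apply/eqP/negPn/negP => w0.
have Hw : H (iter p e v) = (n + 2 * p)%:R *: iter p e v.
  by rewrite (sl2_weight_e _ Hv) natrD.
have [|d d0] := sl2_e_iter_f_highest (j := n + p) (k := 0) Hw ep; first lia.
rewrite addn0 fe linear0 => /esym/eqP; rewrite scaler_eq0 (negPf d0) /=.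
by rewrite (negPf w0).
Qed.

End Sl2.

Section Sl2Theory.
Variables (K : numFieldType) (V : lmodType K) (e f H : {linear V -> V}).
Hypothesis efH : sl2_triple e f H.

Lemma sl2_iter_e_inj v n : H v = - n%:R *: v -> iter n e v = 0 -> v = 0.
Proof.
move=> Hv; apply: (sl2_iter_f_inj (sl2_triple_swap efH)).
by rewrite /= Hv scaleNr opprK.
Qed.

(** The last nonzero [e^n v] is a highest weight vector, of weight [c + 2n]. *)
Lemma sl2_weight_int v c : v != 0 -> H v = c *: v -> exists m : int, c = m%:~R.
Proof.
move=> v0 Hv; case: (efH) => _ _ _ ne _.
have ex : exists n, iter n e v == 0 by have [n ?] := ne v; exists n; apply/eqP.
have [[|n] /eqP ev min] := ex_minnP ex; first by case/eqP: v0.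
have w0 : iter n e v != 0 by apply/negP => /min; rewrite ltnn.
have [M cM _] := sl2_highest_weight efH w0 (sl2_weight_e efH n Hv) ev.
by exists (M%:Z - (2 * n)%:Z); rewrite intrB -!pmulrn -cM addrK.
Qed.

(** Induction on the power of [e] killing [v]. With [w = e^p v] a highest weight vector, subtracting
    a multiple of [f^p w] makes [e^p] kill the rest, and [f^p w] is itself [e^n] of a multiple of
    [f^(n+p) w]. *)
Lemma sl2_iter_e_surj v n : H v = n%:R *: v ->
  exists2 u, H u = - n%:R *: u & v = iter n e u.
Proof.
case: (efH) => _ _ _ ne _; have [p] := ne v.
elim: p v => [|p IH] v /= ev Hv.
  by exists 0; rewrite ?linear0 ?scaler0.
set w := iter p e v.
have Hw : H w = (n + 2 * p)%:R *: w by rewrite (sl2_weight_e efH _ Hv) natrD.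
have [|d d0 dE] := sl2_e_iter_f_highest (j := p) (k := 0) efH Hw ev; first lia.
have [|d' d'0 d'E] := sl2_e_iter_f_highest (j := n) (k := p) efH Hw ev; first lia.
rewrite addn0 /= in dE.
have Hfw : H (iter p f w) = n%:R *: iter p f w.
  by rewrite (sl2_weight_f efH _ Hw) natrD addrK.
have [||u Hu uE] := IH (v - d^-1 *: iter p f w).
- by rewrite linearB linearZ /= dE scalerA mulVf // scale1r subrr.
- by rewrite linearB linearZ /= Hv Hfw scalerBr !scalerA mulrC.
exists (u + (d^-1 * d'^-1) *: iter (n + p) f w).
  rewrite linearD linearZ /= Hu (sl2_weight_f efH _ Hw) scalerDr !scalerA.
  congr (_ + _ *: _); rewrite mulrC; congr (_ * _).
  by rewrite mulnDr !natrD; ring.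
rewrite linearD linearZ /= d'E -uE scalerA mulfVK // subrK //.
Qed.

(* D = [F, f] commutes with e and lowers H-weights by 2.  On a weight vector of
   weight -n < 0, D v would be a highest weight vector of negative weight; a
   weight vector of weight n >= 0 is e^n u with u of weight -n, and e^(n+2) is
   injective on the weight space of D u. *)
Lemma sl2_commutant (F : {linear V -> V}) :
  (forall v, F (e v) = e (F v)) -> (forall v, F (H v) = H (F v)) ->
  forall v c, H v = c *: v -> F (f v) = f (F v).
Proof.
move=> Fe FH; case: (efH) => ef He Hf ne _.
pose D v := F (f v) - f (F v).
suff D0 : forall v c, H v = c *: v -> D v = 0 by move=> v c /D0/subr0_eq.
have De v : D (e v) = e (D v).
  rewrite /D linearB /= Fe -(Fe (f v)) !ef linearD /= FH.
  by rewrite [f (e (F v)) + _]addrC addrKA.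
have Dek k v : D (iter k e v) = iter k e (D v).
  by elim: k => //= k IH; rewrite De IH.
have HD v c : H v = c *: v -> H (D v) = (c - 2) *: D v.
  move=> Hv; rewrite /D linearB /= -FH Hf Hf -FH Hv !linearB !linearZ /=.
  by rewrite !scalerBl !scalerN.
move=> v; have [p] := ne v; elim: p v => [|p IH] v /=.
  by move=> -> c _; rewrite /D !linear0 addr0.
have [-> _ c _|v0] := eqVneq v 0; first by rewrite /D !linear0 addr0.
(* The induction is on the power of [e] killing [v]: [e v] is killed by a smaller one, hence
   [D (e v) = 0]. *)
move=> ep c Hv; have eD : e (D v) = 0.
  rewrite -De; apply: IH (sl2_weight_e efH 1 Hv) => /=.
  by rewrite -iterSr.
have [m cm] := sl2_weight_int v0 Hv; case: m cm => n cn.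
  have [u Hu uE] := sl2_iter_e_surj (etrans Hv (congr1 (fun x => x *: v) cn)).
  have Du : D u = 0.
    apply: (@sl2_iter_e_inj (D u) n.+2).
      by rewrite (HD _ _ Hu) -(addn2 n) natrD; congr (_ *: _); ring.
    by rewrite /= -Dek -uE eD linear0.
  by rewrite uE Dek Du linear0.
apply/eqP/negPn/negP => z0.
have [M /eqP] := sl2_highest_weight efH z0 (HD _ _ Hv) eD.
rewrite cn NegzE intrN -pmulrn -opprD -natrD eq_sym -addr_eq0 -natrD pnatr_eq0.
by rewrite !addnS.
Qed.

End Sl2Theory.

(** * Spans and weights *)

Section Submodules.
Variables (K : nzRingType) (V : lmodType K).
Implicit Types (X W : set V).

Definition submodule W := W 0 /\ forall a u v, W u -> W v -> W (a *: u + v).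

Lemma submoduleP W : submodule W -> GRing.submod_closed [in W].
Proof. by case=> W0 Wl; split=> [|a u v]; rewrite !inE //; apply: Wl. Qed.

Lemma submoduleZ W a u : submodule W -> W u -> W (a *: u).
Proof. by case=> W0 Wl Wu; rewrite -[_ *: _]addr0; apply: Wl. Qed.

Lemma submoduleD W u v : submodule W -> W u -> W v -> W (u + v).
Proof. by case=> W0 Wl Wu Wv; rewrite -[u]scale1r; apply: Wl. Qed.

Lemma submoduleN W u : submodule W -> W u -> W (- u).
Proof. by move=> sW; rewrite -scaleN1r; apply: submoduleZ. Qed.

Lemma submoduleB W u v : submodule W -> W u -> W v -> W (u - v).
Proof. by move=> sW Wu /(submoduleN sW); apply: submoduleD. Qed.

Lemma submodule0 : submodule [set 0].
Proof. by split=> // a u v -> ->; rewrite scaler0 addr0. Qed.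

Inductive lspan X : set V :=
| lspan_zero : lspan X 0
| lspan_add a x v : X x -> lspan X v -> lspan X (a *: x + v).

Lemma lspan_submodule X : submodule (lspan X).
Proof.
split=> [|a u v Xu Xv]; first exact: lspan_zero.
elim: Xu => [|b x w Xx _ IH]; first by rewrite scaler0 add0r.
by rewrite scalerDr scalerA -addrA; apply: lspan_add.
Qed.

Lemma sub_lspan X : X `<=` lspan X.
Proof.
move=> x Xx; rewrite -[x]addr0 -[x]scale1r.
exact: lspan_add Xx (lspan_zero X).
Qed.

Lemma lspan_min X W : submodule W -> X `<=` W -> lspan X `<=` W.
Proof. by move=> [W0 Wl] XW v; elim=> // a x u /XW Wx _; apply: Wl. Qed.

Lemma lspan_singleton x v : lspan [set x] v -> exists c, v = c *: x.
Proof.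
apply: (@lspan_min _ [set v | exists c, v = c *: x]) => [|_ ->]; last first.
  by exists 1; rewrite scale1r.
split=> [|a u w [c ->] [d ->]]; first by exists 0; rewrite scale0r.
by exists (a * c + d); rewrite scalerDl scalerA.
Qed.

Lemma lspan_neq0 X x : x != 0 -> lspan X x -> exists2 y, X y & y != 0.
Proof.
move=> x0 Xx; apply: contrapT => /forall2NP X0; move/eqP: x0; apply.
apply: (lspan_min submodule0) Xx => y Xy /=.
by have [//|/negP/negPn/eqP] := X0 y.
Qed.

End Submodules.

Lemma submodule_preim (K : nzRingType) (V U : lmodType K) (phi : {linear V -> U})
    (W : set U) :
  submodule W -> submodule (phi @^-1` W).
Proof.
case=> W0 Wl; split=> [|a u v Wu Wv]; rewrite /preimage /= ?linear0 //.
by rewrite linearP; apply: Wl.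
Qed.

Lemma lspan_linear (K : nzRingType) (V U : lmodType K) (phi : {linear V -> U})
    (X : set V) (W : set U) :
  submodule W -> (forall x, X x -> W (phi x)) -> forall v, lspan X v -> W (phi v).
Proof.
move=> sW XW v; apply: (@lspan_min _ _ X (phi @^-1` W)) => //.
exact: submodule_preim.
Qed.

Section Weights.
Variables (R : realType) (h : vectType R[i]) (g : lieAlgType R[i]).
Variables (iota : {linear h -> g}) (V : lmodType R[i]) (rho : {bilinear g -> V -> V}).
Local Notation wt := (weight_space iota rho).
Implicit Types (a b : dual h) (v : V).

Lemma weight_submodule a : submodule (wt a).
Proof.
split=> [t|c u v Wu Wv t]; first by rewrite linear0 scaler0.
by rewrite linearD linearZ /= Wu Wv scalerDr !scalerA mulrC.
Qed.

Lemma weight_unique v a b : v != 0 -> wt a v -> wt b v -> a = b.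
Proof.
move=> v0 av bv; apply/lfunP => t; apply/eqP; rewrite -subr_eq0.
have /eqP := av t; rewrite bv -subr_eq0 -scalerBl scaler_eq0 (negPf v0) orbF.
by rewrite -oppr_eq0 opprB.
Qed.

(** A complement to the weight space of [a]. The weights of the summands may repeat, so no indexing
    by distinct weights is required. *)
Definition off_weight a : set V := [set v | exists2 s : seq V,
  (forall x, x \in s -> exists2 b, b != a & wt b x) & v = \sum_(x <- s) x].

Lemma off_weight_submodule a : submodule (off_weight a).
Proof.
split=> [|c _ _ [s sP ->] [s' s'P ->]]; first by exists nil; rewrite ?big_nil.
exists (map ( *:%R c) s ++ s') => [x|].
  rewrite mem_cat => /orP[/mapP[y ys ->]|/s'P//].
  have [b ba Wy] := sP _ ys; exists b => //.
  exact: submoduleZ (weight_submodule b) Wy.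
by rewrite big_cat big_map scaler_sumr.
Qed.

(** Induction on the number of summands. If [b] is the weight of the first one and [a t != b t],
    then [rho (iota t) - b t] kills it, keeps the others in their weight spaces, and multiplies [v]
    by the nonzero [a t - b t]. *)
Lemma off_weight_disjoint a v : wt a v -> off_weight a v -> v = 0.
Proof.
move=> Wv [s sP vE]; have {vE} : v - \sum_(x <- s) x = 0 by rewrite vE subrr.
move: {2}(size s) (erefl (size s)) => n; elim: n s sP v Wv => [|n IH] [|x s] // sP v Wv.
  by rewrite big_nil subr0.
move=> [sn].
have [b ba Wx] := sP x (mem_head _ _).
have [t tP] : exists t, a t != b t.
  apply: contrapT => /forallNP ab; move/eqP: ba; apply; apply/lfunP => t.
  by have /negP/negPn/eqP -> := ab t.
rewrite big_cons => /(congr1 (fun u => rho (iota t) u - (b t : R[i]) *: u)).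
rewrite linear0 scaler0 subrr => E.
have sub y : y \in s -> exists2 b', b' != a & wt b' y.
  by move=> ys; apply: sP; rewrite inE ys orbT.
pose k (y : V) := rho (iota t) y - (b t : R[i]) *: y.
have kE : k v - \sum_(y <- map k s) y = 0.
  rewrite -[RHS]E big_map sumrB -linear_sum -scaler_sumr /k !linearB !linearD. 
  rewrite /= (Wx t) !opprK [RHS]addrACA; congr (_ + _).
  by rewrite [RHS]addrACA addNr add0r.
have kv : k v = ((a t : R[i]) - b t) *: v by rewrite /k Wv scalerBl.
have ksP y : y \in map k s -> exists2 b', b' != a & wt b' y.
  move=> /mapP[z zs ->]; have [b' b'a Wz] := sub z zs; exists b' => //.
  by rewrite /k Wz -scalerBl; apply: submoduleZ (weight_submodule b') Wz.
have Wk : wt a (k v) by rewrite kv; apply: submoduleZ (weight_submodule a) Wv.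
have /eqP := IH _ ksP (k v) Wk (etrans (size_map _ _) sn) kE.
by rewrite kv scaler_eq0 subr_eq0 (negPf tP) => /eqP.
Qed.

(** Every element of the span is a combination of the [x] in [X] of weight [a] plus an off-weight
    part; for [v] of weight [a] the latter vanishes by [off_weight_disjoint]. *)
Lemma lspan_weight (X : set V) a v : (forall x, X x -> exists b, wt b x) ->
  lspan X v -> wt a v -> lspan (X `&` wt a) v.
Proof.
move=> XP Xv Wv.
pose D : set V := [set v | exists2 u, lspan (X `&` wt a) u & off_weight a (v - u)].
have [sA sO] := (lspan_submodule (X `&` wt a), off_weight_submodule a).
have [u Xu vu] : D v.
  apply: (lspan_min _ _ Xv) => [|x Xx].
    split=> [|c x y [u Xu xu] [w Xw yw]].
      by exists 0; [case: sA | rewrite subr0; case: sO].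
    exists (c *: u + w); first by case: sA => _; apply.
    by rewrite opprD addrACA -scalerBr; case: sO => _; apply.
  have [b Wx] := XP _ Xx; have [ba|ba] := eqVneq b a.
    by exists x; [apply: sub_lspan; rewrite -ba | rewrite subrr; case: sO].
  exists 0; [by case: sA | exists (x :: nil); rewrite ?big_seq1 ?subr0 // => y].
  by rewrite inE => /eqP ->; exists b.
suff /subr0_eq -> : v - u = 0 by [].
apply: off_weight_disjoint vu; apply: submoduleB (weight_submodule a) Wv _.
by apply: (lspan_min _ _ Xu) => [|x []//]; apply: weight_submodule.
Qed.

End Weights.

(** * Generation *)

Section SubLie.
Variables (K : fieldType) (g : lieAlgType K) (S : submodClosed g).
Hypothesis lieS : {in S &, forall x y, [: x, y] \in S}.

#[local] HB.instance Definition _ := [SubChoice_isSubLmodule of {x : g | x \in S} by <:].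
Local Notation sub := {x : g | x \in S}.

Definition sub_lie (x y : sub) : sub := exist _ [: sval x, sval y] (lieS (svalP x) (svalP y)).

Lemma sub_lie_linearl y : linear (sub_lie^~ y).
Proof.
move=> c u v; apply: val_inj; rewrite linearP /=.
exact: lie_linearl.
Qed.

Lemma sub_lie_linearr x : linear (sub_lie x).
Proof.
move=> c u v; apply: val_inj; rewrite linearP /=.
exact: lie_linearr.
Qed.

Lemma sub_liexx x : sub_lie x x = 0.
Proof. by apply: val_inj; rewrite /= liexx. Qed.

Lemma sub_lie_jacobi x y z :
  sub_lie x (sub_lie y z) + sub_lie y (sub_lie z x) + sub_lie z (sub_lie x y) = 0.
Proof. by apply: val_inj; rewrite !linearD /= lie_jacobi. Qed.

Definition sub_lieAlg : lieAlgType K := HB.pack sub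
  (Lmodule_isLieAlgebra.Build K sub sub_lie_linearl sub_lie_linearr sub_liexx sub_lie_jacobi).

Definition sub_incl : {linear sub_lieAlg -> g} := (val : {linear sub -> g}).

End SubLie.

Section Generation.
Variables (R : realType) (l : nat) (A : 'M[int]_l) (h : vectType R[i]).
Variables (alpha : 'I_l -> dual h) (acheck : 'I_l -> h).
Variables (g : lieAlgType R[i]) (iota : {linear h -> g}) (e f : 'I_l -> g).

(** [W] is made into a Lie algebra satisfying the relations, which gives a morphism from g to it.
    Followed by the inclusion it fixes the generators, so by uniqueness it is the identity, and
    every [x] lies in [W]. *)
Lemma KacMoody_generated (W : set g) :
  KacMoody_algebra A alpha acheck iota e f ->
  submodule W -> (forall x y, W x -> W y -> W [: x, y]) ->
  (forall t, W (iota t)) -> (forall i, W (e i)) -> (forall i, W (f i)) ->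
  forall x, W x.
Proof.
case=> rel univ sW lieW Wi We Wf x.
pose S : submodClosed g :=
  HB.pack [in W] (GRing.isSubmodClosed.Build R[i] g [in W] (submoduleP sW)).
have inS y : y \in S = W y :> Prop by rewrite inE.
have lieS : {in S &, forall x y, [: x, y] \in S}.
  by move=> y z; rewrite !inS; apply: lieW.
pose L := sub_lieAlg lieS.
have WS y : W y -> y \in S by rewrite inS.
pose mk y (Wy : W y) : L := exist _ y (WS y Wy).
pose incl : {linear L -> g} := sub_incl lieS.
have incl_inj : injective incl by apply: val_inj.
have iota_lin : linear (fun t => mk (iota t) (Wi t)).
  by move=> c t t'; apply: incl_inj; rewrite [RHS]linearP /= linearP.
pose iota' : {linear h -> L} :=
  HB.pack (fun t => mk (iota t) (Wi t)) (GRing.isLinear.Build _ _ _ _ _ iota_lin).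
pose e' i := mk (e i) (We i); pose f' i := mk (f i) (Wf i).
have incl_lie y z : incl [: y, z] = [: incl y, incl z] by [].
have incl_iter n y z : incl (iter n (lie y) z) = iter n (lie (incl y)) (incl z).
  by elim: n => // n IH; rewrite !iterS incl_lie IH.
case: (rel) => hh ef he hf serre.
have rel' : KM_relations A alpha acheck iota' e' f'.
  split=> [t t'|i j|t i|t i|i j ij].
  - by apply: incl_inj; rewrite incl_lie linear0; apply: hh.
  - apply: incl_inj; rewrite incl_lie; have := ef i j.
    by case: eqP => _; rewrite ?linear0.
  - by apply: incl_inj; rewrite incl_lie linearZ; apply: he.
  - by apply: incl_inj; rewrite incl_lie linearZ; apply: hf.
  - by have [? ?] := serre i j ij; split; apply: incl_inj; rewrite incl_iter linear0.
have [phi [phi_lie phi_h phi_e phi_f] _] := univ L iota' e' f' rel'.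
have [id' _ uniq] := univ g iota e f rel.
have -> : x = incl (phi x).
  rewrite -[LHS]/(idfun x) (uniq idfun) // -(uniq (incl \o phi)) //.
  split=> [y z|t|i|i] /=; first by rewrite phi_lie.
  - by rewrite phi_h.
  - by rewrite phi_e.
  - by rewrite phi_f.
by rewrite -inS; exact: (svalP (phi x)).
Qed.

End Generation.

Lemma nilpotent_submodule (K : nzRingType) (V : lmodType K) (phi : {linear V -> V}) :
  submodule [set v | exists n, iter n phi v = 0].
Proof.
split=> [|a u v [n nu] [m mv]]; first by exists 0.
exists (n + m)%N; rewrite linearP /= {1}addnC !iterD nu mv !linear0.
by rewrite scaler0 addr0.
Qed.

Section LieBilinear.
Variables (R : realType) (g : lieAlgType R[i]).
Implicit Types x y z : g.

HB.instance Definition _ := bilinear_isBilinear.Build R[i] g g g *:%R *:%R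
  (@lie _ g) (conj (@lie_linearl _ g) (@lie_linearr _ g)).

HB.instance Definition _ x := GRing.isLinear.Build R[i] g g _ (lie x) (lie_linearr x).

Lemma lieC x y : [: x, y] = - [: y, x].
Proof.
apply/eqP; rewrite -addr_eq0; apply/eqP.
by have := liexx (x + y); rewrite linearDl !linearDr /= !liexx add0r addr0 addrC.
Qed.

Lemma lie_ad x y z : [: x, [: y, z]] = [: [: x, y], z] + [: y, [: x, z]].
Proof.
have /eqP := lie_jacobi x y z; rewrite [ [: z, x] ]lieC [ [: z, _] ]lieC linearNr.
by rewrite -addrA addr_eq0 opprD !opprK addrC => /eqP.
Qed.

Lemma lie_lie_module : lie_module (@lie _ g).
Proof. by move=> x y v; rewrite -[RHS]/([: x, [: y, v]] - [: y, [: x, v]]) lie_ad addrK. Qed.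

(** By the Leibniz rule, each term puts at least [p] factors on [x] or at least [q] on [y]. *)
Lemma iter_ad_nil (phi : g) p q x y :
  iter p (lie phi) x = 0 -> iter q (lie phi) y = 0 ->
  iter (p + q) (lie phi) [: x, y] = 0.
Proof.
move: {2}(p + q)%N (erefl (p + q)%N) => n; elim: n p q x y => [|n IH] p q x y.
  by case: p q => [|//] [|//] _ /= -> _; rewrite linear0l.
case: p => [|p] pq px qy; first by rewrite [x]px linear0l linear0.
case: q pq qy => [|q] pq qy; first by rewrite [y]qy !linear0.
rewrite pq iterSr lie_ad linearD /=.
rewrite -{1}(_ : p + q.+1 = n)%N ?IH //; try lia; last by rewrite -iterSr.
by rewrite -(_ : p.+1 + q = n)%N ?IH ?addr0 //; try lia; rewrite -iterSr.
Qed.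

End LieBilinear.

(** * Triangular decomposition and root spaces *)

Section Lattice.
Variables (R : realType) (l : nat) (h : vectType R[i]) (alpha : 'I_l -> dual h).
Implicit Types (n m : 'I_l -> int).

Definition root_lattice n : dual h := \sum_i alpha i *~ n i.
Local Notation lat := root_lattice.

Definition lattice_free := forall n m, lat n = lat m -> n =1 m.

Lemma free_lattice_free : free (codom alpha) -> lattice_free.
Proof.
move=> fr n m E i.
have fr' : free (mktuple alpha) by rewrite (_ : val _ = codom alpha) // codomE.
have /freeP/(_ (fun j => (n j - m j)%:~R)) := fr'.
rewrite (eq_bigr (fun j => alpha j *~ n j - alpha j *~ m j)); last first.
  move=> j _; rewrite (nth_map j) ?size_enum_ord // nth_ord_enum.
  by rewrite scaler_int mulrzBr.
rewrite sumrB [X in X - _]E subrr => /(_ erefl i)/eqP.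
by rewrite intr_eq0 subr_eq0 => /eqP.
Qed.

Lemma eq_lattice n m : n =1 m -> lat n = lat m.
Proof. by move=> nm; apply: eq_bigr => i _; rewrite nm. Qed.

Lemma latticeD n m : lat (fun i => n i + m i) = lat n + lat m.
Proof. by rewrite -big_split; apply: eq_bigr => i _; rewrite mulrzDr. Qed.

Lemma lattice0 : lat (fun=> 0) = 0.
Proof. by rewrite /lat big1. Qed.

Lemma lattice_delta i : lat (fun j => (j == i)%:Z) = alpha i.
Proof.
rewrite /lat (bigD1 i) //= eqxx mulr1z big1 ?addr0 // => j /negPf ->.
by rewrite mulr0z.
Qed.

Lemma lattice_seq (s : seq 'I_l) :
  \sum_(i <- s) alpha i = lat (fun i => (count_mem i s)%:Z).
Proof.
elim: s => [|j s IH]; first by rewrite big_nil -[LHS]lattice0.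
rewrite big_cons IH -(lattice_delta j) -latticeD; apply: eq_lattice => i /=.
by rewrite PoszD eq_sym.
Qed.

End Lattice.

Section Setting.
Variables (R : realType) (l : nat) (A : 'M[int]_l) (h : vectType R[i]).
Variables (g : lieAlgType R[i]) (iota : {linear h -> g}).

Definition lie_generated (e f : 'I_l -> g) := forall W : set g,
  submodule W -> (forall x y, W x -> W y -> W [: x, y]) ->
  (forall t, W (iota t)) -> (forall i, W (e i)) -> (forall i, W (f i)) ->
  forall x, W x.

(* Invariant under the exchange (alpha, acheck, e, f) -> (-alpha, -acheck, f, e),
   so that every statement about positive roots also applies to negative ones. *)
Definition KM_setting (alpha : 'I_l -> dual h) (acheck : 'I_l -> h) (e f : 'I_l -> g) :=
  [/\ KM_relations A alpha acheck iota e f, lie_generated e f, lattice_free alpha,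
      forall i j, alpha j (acheck i) = (A i j)%:~R & forall i, A i i = 2].

Lemma KM_setting_swap alpha acheck e f : KM_setting alpha acheck e f ->
  KM_setting (fun i => - alpha i) (fun i => - acheck i) f e.
Proof.
case=> -[hh ef he hf serre] gen fr cart diag; split=> //.
- split=> // [i j|t i|t i|i j ij].
  + by rewrite lieC ef eq_sym; case: eqP => [->|]; rewrite ?linearN ?oppr0.
  + by rewrite opp_lfunE hf.
  + by rewrite opp_lfunE opprK he.
  + by have [? ?] := serre i j ij.
- by move=> W sW lieW Wi Wf We; apply: gen.
- have latN n : root_lattice (fun i => - alpha i) n = - root_lattice alpha n.
    by rewrite -sumrN; apply: eq_bigr => i _; rewrite mulNrz.
  by move=> n m; rewrite !latN => /oppr_inj/fr.
- by move=> i j; rewrite opp_lfunE linearN opprK /= cart.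
Qed.

End Setting.

Section Monomials.
Variables (R : realType) (l : nat) (A : 'M[int]_l) (h : vectType R[i]).
Variables (g : lieAlgType R[i]) (iota : {linear h -> g}).
Implicit Types (alpha : 'I_l -> dual h) (acheck : 'I_l -> h) (e f : 'I_l -> g).

Local Notation wt := (weight_space iota (@lie _ g)).

Definition monomial (x : 'I_l -> g) i s := foldr (fun j => lie (x j)) (x i) s.
Definition monomials x : set g := [set y | exists i s, y = monomial x i s].

Lemma monomial_weight alpha acheck e f i s : KM_setting A iota alpha acheck e f ->
  wt (root_lattice alpha (fun j => (count_mem j (i :: s))%:Z)) (monomial e i s).
Proof.
case=> -[_ _ he _ _] _ _ _ _.
rewrite -lattice_seq big_cons addrC; elim: s => [|j s IH] t /=.
  by rewrite big_nil add0r he.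
rewrite big_cons /= lie_ad he linearZl_LR /= IH linearZ /=.
by rewrite -addrA [in RHS]add_lfunE scalerDl.
Qed.

Lemma monomial_weight_neg alpha acheck e f i s : KM_setting A iota alpha acheck e f ->
  wt (- root_lattice alpha (fun j => (count_mem j (i :: s))%:Z)) (monomial f i s).
Proof.
move=> /KM_setting_swap/(monomial_weight i s).
by rewrite /root_lattice -sumrN; under eq_bigr do rewrite mulNrz.
Qed.

(** ad [e_k] is a derivation: on the outer letter it gives an element of h, which scales the
    remaining monomial; on the inner monomial induction applies. Elements of h appear when a single
    letter is left. *)
Lemma bracket_generator_monomial alpha acheck e f k i s :
  KM_setting A iota alpha acheck e f ->
  lspan (range iota `|` monomials f) [: e k, monomial f i s].
Proof.
move=> KM; case: (KM) => -[hh ef he hf _] _ _ _ _.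
have sN := lspan_submodule (range iota `|` monomials f).
elim: s => [|j s IH] /=.
  rewrite ef; case: eqP => _; last by case: sN.
  by apply: sub_lspan; left; exists (acheck k).
rewrite lie_ad; apply: submoduleD => //.
  rewrite ef; case: eqP => _; last by rewrite linear0l; case: sN.
  rewrite (monomial_weight_neg i s KM); apply: (submoduleZ _ sN); apply: sub_lspan.
  by right; exists i, s.
apply: lspan_linear (sN) _ _ IH => _ [[t _ <-]|[i' [s' ->]]].
  rewrite /= lieC hf; apply: (submoduleN sN); apply: (submoduleZ _ sN); apply: sub_lspan.
  by right; exists j, nil.
by apply: sub_lspan; right; exists i', (j :: s').
Qed.

Lemma triangular_bracket alpha acheck e f k x :
  KM_setting A iota alpha acheck e f ->
  lspan (range iota `|` (monomials e `|` monomials f)) x ->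
  lspan (range iota `|` (monomials e `|` monomials f)) [: e k, x].
Proof.
move=> KM; case: (KM) => -[_ _ he _ _] _ _ _ _.
have sM := lspan_submodule (range iota `|` (monomials e `|` monomials f)).
apply: lspan_linear (sM) _ x => _ [[t _ <-]|[[i [s ->]]|[i [s ->]]]].
- rewrite /= lieC he; apply: (submoduleN sM); apply: (submoduleZ _ sM); apply: sub_lspan.
  by right; left; exists k, nil.
- by apply: sub_lspan; right; left; exists i, (k :: s).
- apply: lspan_min (bracket_generator_monomial k i s KM) => // y [?|?].
    by apply: sub_lspan; left.
  by apply: sub_lspan; right; right.
Qed.

(** Only the spanning half of the triangular decomposition; comparison of weights later separates
    the three pieces. *)
Lemma triangular alpha acheck e f x : KM_setting A iota alpha acheck e f ->
  lspan (range iota `|` (monomials e `|` monomials f)) x.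
Proof.
move=> KM; set M := lspan _; have sM : submodule M by apply: lspan_submodule.
case: (KM) => -[hh _ _ _ _] gen _ _ _.
have Mi t : M (iota t) by apply: sub_lspan; left; exists t.
have Me i : M (e i) by apply: sub_lspan; right; left; exists i, nil.
have Mf i : M (f i) by apply: sub_lspan; right; right; exists i, nil.
(* By Jacobi the elements whose bracket preserves [M] form a subalgebra. It contains the generators,
   so [M] is an ideal, in particular a subalgebra, and it contains the generators too. *)
have idealM y : [set y | forall z, M z -> M [: y, z]] y.
  apply: gen y => [|y z My Mz u Mu|t|i|i] /=.
  - split=> [z _|c u v Wu Wv z Mz]; first by rewrite linear0l; case: sM.
    rewrite linearPl; case: sM => _; apply; [exact: Wu | exact: Wv].
  - rewrite (lie_lie_module y z u); apply: (submoduleB sM).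
      exact/My/Mz.
    exact/Mz/My.
  - apply: lspan_linear (sM) _ => _ [[t' _ <-]|[[i [s ->]]|[i [s ->]]]].
    + by rewrite /= hh; case: sM.
    + rewrite /= (monomial_weight i s KM); apply: (submoduleZ _ sM); apply: sub_lspan.
      by right; left; exists i, s.
    + rewrite /= (monomial_weight_neg i s KM); apply: (submoduleZ _ sM); apply: sub_lspan.
      by right; right; exists i, s.
  - by move=> z; apply: triangular_bracket KM.
  - move=> z; rewrite /M [monomials e `|` _]setUC.
    exact: triangular_bracket (KM_setting_swap KM).
by apply: gen x => // y z _; apply: idealM.
Qed.

(** The vectors killed by a power of ad [e_i] form a subalgebra. It contains h (power 2), each [e_j]
    by the Serre relations, and [f_j], which ad [e_i] sends into h. *)
Lemma ad_nilpotent alpha acheck e f i x : KM_setting A iota alpha acheck e f ->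
  exists n, iter n (lie (e i)) x = 0.
Proof.
case=> -[hh ef he hf serre] gen _ _ _.
have sW := nilpotent_submodule (lie (e i)).
have nil_h t : exists n, iter n (lie (e i)) (iota t) = 0.
  by exists 2; rewrite /= [ [: e i, iota t] ]lieC he linearN linearZ /= liexx scaler0 oppr0.
apply: (gen _ sW) x => // [x y [n xn] [m ym]|j|j] /=.
- by exists (n + m)%N; apply: iter_ad_nil.
- have [<-|ij] := eqVneq i j; first by exists 1; rewrite /= liexx.
  by have [ej _] := serre _ _ ij; exists (absz (1 - A i j)%R).
- have [n Hn] : exists n, iter n (lie (e i)) [: e i, f j] = 0.
    by rewrite ef; case: eqP => _; [apply: nil_h | exists 0].
  by exists n.+1; rewrite iterSr.
Qed.

End Monomials.

(** * Root spaces: signs, weight zero, multiples of a simple root *)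

Section RootSpaces.
Variables (R : realType) (l : nat) (A : 'M[int]_l) (h : vectType R[i]).
Variables (g : lieAlgType R[i]) (iota : {linear h -> g}).
Variables (alpha : 'I_l -> dual h) (acheck : 'I_l -> h) (e f : 'I_l -> g).
Hypothesis KM : KM_setting A iota alpha acheck e f.
Implicit Types (n : 'I_l -> nat) (a : dual h) (x : g).

Local Notation wt := (weight_space iota (@lie _ g)).
Definition nat_lattice n := root_lattice alpha (fun i => (n i)%:Z).
Local Notation lat := nat_lattice.

Lemma nat_lattice_inj n m : lat n = lat m -> n =1 m.
Proof. by case: KM => _ _ fr _ _ /fr nm i; case: (nm i). Qed.

Lemma nat_latticeD n m : lat (fun i => n i + m i)%N = lat n + lat m.
Proof. by rewrite -latticeD; apply: eq_lattice => i; rewrite PoszD. Qed.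

Lemma nat_lattice0 : lat (fun=> 0%N) = 0.
Proof. exact: lattice0. Qed.

Lemma nat_lattice_add0 n m : lat n + lat m = 0 -> forall i, n i = 0%N.
Proof.
rewrite -nat_latticeD -nat_lattice0 => /nat_lattice_inj nm i; have := nm i; lia.
Qed.

Lemma iota_weight t : wt 0 (iota t).
Proof. by case: KM => -[hh _ _ _ _] _ _ _ _ t' /=; rewrite hh zero_lfunE scale0r. Qed.

Lemma triangular_weight a x : wt a x ->
  lspan ((range iota `|` (monomials e `|` monomials f)) `&` wt a) x.
Proof.
apply: lspan_weight (triangular x KM) => _ [[t _ <-]|[[i [s ->]]|[i [s ->]]]].
- by exists 0; apply: iota_weight.
- by eexists; apply: monomial_weight KM.
- by eexists; apply: monomial_weight_neg KM.
Qed.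

(** Some nonzero spanning element has the same weight as [x]. The case [a = 0] is included, with
    [n = 0]. *)
Lemma root_sign a x : x != 0 -> wt a x -> exists n, a = lat n \/ a = - lat n.
Proof.
move=> x0 /triangular_weight/(lspan_neq0 x0)[y [Xy Wy] y0].
case: Xy Wy y0 => [[t _ <-]|[[i [s ->]]|[i [s ->]]]] Wy y0.
- exists (fun=> 0%N); left; rewrite nat_lattice0.
  exact: weight_unique y0 Wy (iota_weight t).
- exists (fun j => count_mem j (i :: s)); left.
  exact: weight_unique y0 Wy (monomial_weight _ _ KM).
- exists (fun j => count_mem j (i :: s)); right.
  exact: weight_unique y0 Wy (monomial_weight_neg _ _ KM).
Qed.

Lemma zero_weight x : wt 0 x -> exists t, x = iota t.
Proof.
move=> /triangular_weight; apply: (@lspan_min _ _ _ [set x | exists t, x = iota t]).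
  split=> [|c _ _ [t ->] [t' ->]]; first by exists 0; rewrite linear0.
  by exists (c *: t + t'); rewrite linearP.
move=> y [Xy Wy]; have [->|y0] := eqVneq y 0; first by exists 0; rewrite linear0.
case: Xy Wy y0 => [[t _ <-]|[[i [s ->]]|[i [s ->]]]] Wy y0; first by exists t.
- have := weight_unique y0 Wy (monomial_weight i s KM); rewrite -[0]addr0.
  rewrite -{1}nat_lattice0 -{1}nat_lattice0 -nat_latticeD => /nat_lattice_inj/(_ i) /=.
  by rewrite eqxx.
- have /eqP := weight_unique y0 Wy (monomial_weight_neg i s KM).
  rewrite eq_sym oppr_eq0 -nat_lattice0 => /eqP/nat_lattice_inj/(_ i) /=.
  by rewrite eqxx.
Qed.

Lemma positive_weight n i0 x : (0 < n i0)%N -> wt (lat n) x ->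
  lspan [set y | exists i s, y = monomial e i s /\ forall j, count_mem j (i :: s) = n j] x.
Proof.
move=> n0 /triangular_weight; apply: lspan_min; first exact: lspan_submodule.
move=> y [Xy Wy]; have [->|y0] := eqVneq y 0; first exact: lspan_zero.
case: Xy Wy y0 => [[t _ <-]|[[i [s ->]]|[i [s ->]]]] Wy y0.
- have := weight_unique y0 Wy (iota_weight t); rewrite -nat_lattice0.
  by move/nat_lattice_inj/(_ i0) => n00; rewrite n00 in n0.
- apply: sub_lspan; exists i, s; split=> // j.
  by have /nat_lattice_inj/(_ j) := weight_unique y0 Wy (monomial_weight i s KM).
- have /eqP := weight_unique y0 Wy (monomial_weight_neg i s KM).
  rewrite -addr_eq0 => /eqP/nat_lattice_add0/(_ i0) n00; by rewrite n00 in n0.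
Qed.

Lemma simple_multiple_weight i k x : wt (alpha i *+ k.+1) x ->
  exists c, x = c *: monomial e i (nseq k i).
Proof.
have -> : alpha i *+ k.+1 = lat (fun j => count_mem j (nseq k.+1 i)).
  by rewrite /lat -lattice_seq big_nseq iter_addr addr0.
move/(@positive_weight _ i); rewrite count_nseq /= eqxx => /(_ isT).
apply: (@lspan_min _ _ _ [set x | exists c, x = c *: monomial e i (nseq k i)]).
  split=> [|c _ _ [d ->] [d' ->]]; first by exists 0; rewrite scale0r.
  by exists (c * d + d'); rewrite scalerDl scalerA.
move=> _ [j [s [-> cnt]]].
have : perm_eq (j :: s) (nseq k.+1 i) by apply/allP => j' _; apply/eqP/cnt.
move=> js; have /all_pred1P : all (pred1 i) (j :: s).
  by rewrite (perm_all _ js) all_pred1_nseq.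
rewrite (perm_size js) size_nseq => -[-> ->].
by exists 1; rewrite scale1r.
Qed.

Lemma simple_weight i x : wt (alpha i) x -> exists c, x = c *: e i.
Proof. by move=> Wx; apply: (@simple_multiple_weight i 0 x). Qed.

(** The only monomial of this weight uses the letter [i] alone, and its innermost bracket is
    [[e_i, e_i] = 0]. *)
Lemma simple_multiple_weight0 i k x : wt (alpha i *+ k.+2) x -> x = 0.
Proof.
move=> /simple_multiple_weight[c ->]; rewrite (_ : monomial _ _ _ = 0) ?scaler0 //.
elim: k => [|k]; first exact: liexx.
by move=> IH; rewrite -[LHS]/[: e i, monomial e i (nseq k.+1 i)] IH linear0.
Qed.

End RootSpaces.

(** * Weyl group *)

Section WeightAction.
Variables (R : realType) (h : vectType R[i]) (g : lieAlgType R[i]).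
Variables (iota : {linear h -> g}) (V : lmodType R[i]) (rho : {bilinear g -> V -> V}).
Hypothesis rhoM : lie_module rho.
Implicit Types (a b : dual h) (x : g) (v : V).

Local Notation wt := (weight_space iota rho).

Lemma act_weight a b x v : root_space iota a x -> wt b v -> wt (b + a) (rho x v).
Proof.
move=> ax bv t; have /eqP := rhoM (iota t) x v; rewrite ax bv.
rewrite linearZl_LR linearZ /= eq_sym subr_eq => /eqP ->.
by rewrite [in RHS]add_lfunE [in RHS]addrC scalerDl.
Qed.

Lemma iter_act_weight a b x v n : root_space iota a x -> wt b v ->
  wt (b + a *+ n) (iter n (rho x) v).
Proof.
move=> ax bv; elim: n => [|n IH]; first by rewrite addr0.
by rewrite mulrSr addrA; apply: act_weight.
Qed.

Lemma module_sl2_triple x y z :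
  [: x, y] = z -> [: z, x] = 2 *: x -> [: z, y] = - 2 *: y ->
  locally_nilpotent (rho x) -> locally_nilpotent (rho y) ->
  sl2_triple (rho x) (rho y) (rho z).
Proof.
move=> xy zx zy nx ny; split=> // v.
- by rewrite /= -xy rhoM addrC subrK.
- by have /eqP := rhoM z x v; rewrite zx linearZl_LR /= eq_sym subr_eq addrC => /eqP.
- have /eqP := rhoM z y v; rewrite zy linearZl_LR /= eq_sym subr_eq addrC => /eqP ->.
  by rewrite scaleNr.
Qed.

Definition weights : set (dual h) := [set a | exists2 v, v != 0 & wt a v].

End WeightAction.

Section Weyl.
Variables (R : realType) (l : nat) (A : 'M[int]_l) (h : vectType R[i]).
Variables (g : lieAlgType R[i]) (iota : {linear h -> g}).
Variables (alpha : 'I_l -> dual h) (acheck : 'I_l -> h) (e f : 'I_l -> g).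
Hypothesis KM : KM_setting A iota alpha acheck e f.
Implicit Types (a b : dual h) (P : set (dual h)).

Definition simple_reflection i a : dual h := a - (a (acheck i) : R[i]) *: alpha i.
Local Notation refl := simple_reflection.

(** The orbit of the simple roots under the Weyl group, described without introducing the group. *)
Inductive weyl_orbit : dual h -> Prop :=
| weyl_simple i : weyl_orbit (alpha i)
| weyl_refl i a : weyl_orbit a -> weyl_orbit (refl i a).

Lemma alpha_acheck i : (alpha i (acheck i) : R[i]) = 2.
Proof. by case: KM => _ _ _ cart diag; rewrite cart diag. Qed.

Lemma refl_simple i : refl i (alpha i) = - alpha i.
Proof. by rewrite /refl alpha_acheck scaler_nat mulr2n opprD addrA subrr add0r. Qed.

Lemma refl_add i a b : refl i (a + b) = refl i a + refl i b.
Proof. by rewrite /refl add_lfunE scalerDl opprD addrACA. Qed.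

Lemma refl_opp i a : refl i (- a) = - refl i a.
Proof. by rewrite /refl opp_lfunE scaleNr opprB opprK addrC. Qed.

Lemma refl_muln i a n : refl i (a *+ n) = refl i a *+ n.
Proof.
elim: n => [|n IH]; first by rewrite /refl zero_lfunE scale0r subr0.
by rewrite !mulrS refl_add IH.
Qed.

Lemma reflK i : involutive (refl i).
Proof.
move=> a; rewrite {1}/refl {1}/refl add_lfunE opp_lfunE scale_lfunE alpha_acheck.
rewrite (_ : _ - _ *: 2 = - (a (acheck i) : R[i])).
  by rewrite scaleNr opprK subrK.
rewrite -[_ *: 2]/((a (acheck i) : R[i]) * 2); ring.
Qed.

Lemma weyl_orbit_opp a : weyl_orbit a -> weyl_orbit (- a).
Proof.
elim=> [i|i b _ IH]; last by rewrite -refl_opp; apply: weyl_refl.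
by rewrite -refl_simple; apply/weyl_refl/weyl_simple.
Qed.

(** * Finiteness of weight strings in the direction of a real root *)

Section Strings.
(** [P] will be the weights of g or of V. [P_half] asks for a bound on one side only, because for g
    the side that is easily bounded depends on the sign of the root. *)
Variable P : set (dual h).
Hypothesis P_int : forall a i, P a -> exists m : int, (a (acheck i) : R[i]) = m%:~R.
Hypothesis P_refl : forall a i, P a -> P (refl i a).
Hypothesis P_half : forall a i, P a ->
  (exists N, forall k, (N <= k)%N -> ~ P (a + alpha i *+ k)) \/
  (exists N, forall k, (N <= k)%N -> ~ P (a - alpha i *+ k)).

Lemma simple_string a i : P a ->
  exists N, forall k, (N <= k)%N -> ~ P (a + alpha i *+ k).
Proof.
move=> Pa; case: (P_half i Pa) => [//|[N PN]].
(* [s_i (a + k alpha_i) = a - (m + k) alpha_i], and [m + k >= N] as soon as [k >= N + |m|]. *)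
have [m am] := P_int i Pa; exists (N + absz m)%N => k Nk /(@P_refl _ i).
rewrite refl_add refl_muln refl_simple /refl am scaler_int mulNrn -addrA -opprD.
rewrite !pmulrn -mulrzDr.
have -> : m + k = (absz (m + k)%R)%:Z by lia.
rewrite -pmulrn; apply: PN; lia.
Qed.

(** [s_i] carries the string through [a] in direction [s_i b] to the string through [s_i a] in
    direction [b]. *)
Lemma weyl_string a b : weyl_orbit b -> P a ->
  exists N, forall k, (N <= k)%N -> ~ P (a + b *+ k).
Proof.
move=> Wb; elim: Wb a => [i|i {}b _ IH] a Pa; first exact: simple_string.
have [N PN] := IH _ (P_refl i Pa); exists N => k /PN nP /(@P_refl _ i).
by rewrite refl_add refl_muln reflK.
Qed.

End Strings.

Section Integrable.
Variables (V : lmodType R[i]) (rho : {bilinear g -> V -> V}).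
Hypotheses (rhoM : lie_module rho) (rhoI : integrable_module e f rho).
Local Notation wt := (weight_space iota rho).

Lemma simple_sl2_triple i :
  sl2_triple (rho (e i)) (rho (f i)) (rho (iota (acheck i))).
Proof.
case: (KM) => -[_ ef he hf _] _ _ _ _; have [ne nf] := rhoI i.
apply: module_sl2_triple => //; first by rewrite ef eqxx.
  by rewrite he alpha_acheck.
by rewrite hf alpha_acheck.
Qed.

Lemma weights_int a i : weights iota rho a -> exists m : int, (a (acheck i) : R[i]) = m%:~R.
Proof. case=> v v0 Wv. exact: (sl2_weight_int (simple_sl2_triple i) v0 (Wv _)). Qed.

(** A power of [f_i] or [e_i], according to the sign of [m], moves [v] to the reflected weight, and
    sl2-theory keeps it nonzero. *)
Lemma weights_refl a i : weights iota rho a -> weights iota rho (refl i a).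
Proof.
move=> Pa; have [m am] := weights_int i Pa; case: Pa => v v0 Wv.
have sl2 := simple_sl2_triple i; case: (KM) => -[_ _ he hf _] _ _ _ _.
have Hv := Wv (acheck i); rewrite am in Hv.
rewrite /refl am; case: m {am} Hv => n Hv.
  exists (iter n (rho (f i)) v).
    by apply/eqP => /(sl2_iter_f_inj sl2 Hv)/eqP; apply/negP.
  rewrite -pmulrn scaler_nat -mulNrn; apply: iter_act_weight => // t.
  by rewrite hf opp_lfunE.
rewrite NegzE intrN -pmulrn in Hv *.
exists (iter n.+1 (rho (e i)) v).
  by apply/eqP => /(sl2_iter_e_inj sl2 Hv)/eqP; apply/negP.
by rewrite scaleNr opprK scaler_nat; apply: iter_act_weight.
Qed.

Lemma weyl_nilpotent b x :
  (forall v, lspan [set w | exists a, wt a w] v) ->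
  (forall a, weights iota rho a -> 
     exists N, forall k, (N <= k)%N -> ~ weights iota rho (a + b *+ k)) ->
  root_space iota b x -> locally_nilpotent (rho x).
Proof.
move=> spanV bd bx v; apply: (lspan_min (nilpotent_submodule (rho x))) (spanV v).
move=> w [a Ww] /=; have [->|w0] := eqVneq w 0; first by exists 0%N.
have [|N PN] := bd a; first by exists w.
exists N; apply/eqP/negPn/negP => xw0; apply: (PN N (leqnn N)).
by exists (iter N (rho x) w) => //; apply: iter_act_weight.
Qed.

End Integrable.
End Weyl.

(** * Root strings and nilpotency in the adjoint module *)

Section AdjointModule.
Variables (R : realType) (l : nat) (A : 'M[int]_l) (h : vectType R[i]).
Variables (g : lieAlgType R[i]) (iota : {linear h -> g}).
Implicit Types (alpha : 'I_l -> dual h) (acheck : 'I_l -> h) (e f : 'I_l -> g).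
Local Notation wts := (weights iota (@lie _ g)).

Lemma lie_integrable alpha acheck e f : KM_setting A iota alpha acheck e f ->
  integrable_module e f (@lie _ g).
Proof.
move=> KM i; split=> x; first exact: ad_nilpotent KM.
exact: ad_nilpotent (KM_setting_swap KM).
Qed.

Lemma lie_weight_span alpha acheck e f x : KM_setting A iota alpha acheck e f ->
  lspan [set y | exists a, weight_space iota (@lie _ g) a y] x.
Proof.
move=> KM; apply: lspan_min (triangular x KM); first exact: lspan_submodule.
move=> _ [[t _ <-]|[[i [s ->]]|[i [s ->]]]]; apply: sub_lspan; eexists.
- exact: iota_weight KM _.
- exact: monomial_weight KM.
- exact: monomial_weight_neg KM.
Qed.

Lemma nat_lattice_supp alpha i (n : 'I_l -> nat) : (forall j, j != i -> n j = 0%N) ->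
  nat_lattice alpha n = alpha i *+ n i.
Proof.
move=> nj; rewrite /nat_lattice /root_lattice (bigD1 i) //= big1 ?addr0 // => j ji.
by rewrite nj.
Qed.

(** If another simple root occurs in [n], subtracting more than [n i] copies of [alpha i] would give
    coefficients of both signs. Otherwise the weight is a multiple of [alpha i], and adding two
    copies leaves the weights. *)
Lemma lie_string_pos alpha acheck e f (n : 'I_l -> nat) i :
  KM_setting A iota alpha acheck e f ->
  (exists N, forall k, (N <= k)%N -> ~ wts (nat_lattice alpha n + alpha i *+ k)) \/
  (exists N, forall k, (N <= k)%N -> ~ wts (nat_lattice alpha n - alpha i *+ k)).
Proof.
move=> KM; have [[j ji n0]|nj] := pselect (exists2 j, j != i & n j != 0%N).
  right; exists (n i).+1 => k nk [x x0 Wx].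
  have [m] := root_sign KM x0 Wx.
  have -> : alpha i *+ k = nat_lattice alpha (fun j => (j == i) * k)%N.
    rewrite (@nat_lattice_supp _ i) ?eqxx ?mul1n // => j' /negPf -> //.
  case=> /eqP; rewrite subr_eq.
    by rewrite -nat_latticeD => /eqP/(nat_lattice_inj KM)/(_ i); rewrite eqxx; lia.
  rewrite addrC eq_sym subr_eq -nat_latticeD => /eqP/(nat_lattice_inj KM)/(_ j).
  by rewrite (negPf ji) mul0n; move: n0; lia.
left; exists 2%N => k k2 [x x0 Wx]; move/eqP: x0; apply.
rewrite (@nat_lattice_supp _ i) in Wx; last first.
  by move=> j ji; apply/eqP/negPn/negP => n0; apply: nj; exists j.
rewrite -mulrnDr (_ : n i + k = (n i + k - 2).+2)%N in Wx; last by lia.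
exact: simple_multiple_weight0 KM _ _ _ Wx.
Qed.

Lemma lie_string alpha acheck e f a i : KM_setting A iota alpha acheck e f ->
  wts a ->
  (exists N, forall k, (N <= k)%N -> ~ wts (a + alpha i *+ k)) \/
  (exists N, forall k, (N <= k)%N -> ~ wts (a - alpha i *+ k)).
Proof.
move=> KM [x x0 /(root_sign KM x0)[n [->|->]]]; first exact: lie_string_pos KM.
have := lie_string_pos n i (KM_setting_swap KM).
have -> : nat_lattice (fun i => - alpha i) n = - nat_lattice alpha n.
  by rewrite /nat_lattice /root_lattice -sumrN; apply: eq_bigr => j _; rewrite mulNrz.
case=> -[N PN]; [right|left]; exists N => k /PN; rewrite mulNrn //.
by rewrite opprK.
Qed.

Lemma lie_weyl_string alpha acheck e f a b : KM_setting A iota alpha acheck e f ->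
  weyl_orbit alpha acheck b -> wts a ->
  exists N, forall k, (N <= k)%N -> ~ wts (a + b *+ k).
Proof.
move=> KM; have rhoM := @lie_lie_module _ g.
have rhoI := lie_integrable KM.
apply: (weyl_string KM) => a' i.
- exact: (weights_int KM rhoM rhoI).
- exact: (weights_refl KM rhoM rhoI).
- exact: lie_string KM.
Qed.

Lemma lie_weyl_nilpotent alpha acheck e f b x : KM_setting A iota alpha acheck e f ->
  weyl_orbit alpha acheck b -> root_space iota b x -> locally_nilpotent (lie x).
Proof.
move=> KM Wb; apply: (weyl_nilpotent (@lie_lie_module _ g)) => [y|a].
  exact: lie_weight_span KM.
exact: lie_weyl_string KM Wb.
Qed.

End AdjointModule.

(** * Real roots *)

Section DualForm.
Variables (R : realType) (h : vectType R[i]) (g : lieAlgType R[i]).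
Variables (iota : {linear h -> g}) (B : {symmetric g}).
Implicit Types (a b : dual h) (x y : g).
Local Notation form := (dual_form iota B).

Lemma form_sym x y : B x y = B y x.
Proof. by rewrite hermC expr0 mul1r. Qed.

Lemma dual_form_sym a b : form a b = form b a.
Proof. exact: form_sym. Qed.

Lemma dual_form_linear b : linear (fun a => form a b : R[i]^o).
Proof. by move=> c a a'; rewrite /dual_form !linearP linearPl. Qed.

Lemma dual_formD a a' b : form (a + a') b = form a b + form a' b.
Proof. by have := dual_form_linear b 1 a a'; rewrite !scale1r. Qed.

Lemma dual_form0 b : form 0 b = 0.
Proof. by apply: (addrI (form 0 b)); rewrite -dual_formD !addr0. Qed.

Lemma dual_formZ c a b : form (c *: a) b = c * form a b.
Proof.
have := dual_form_linear b c a 0; rewrite addr0 => ->.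
by rewrite dual_form0 addr0.
Qed.

Lemma dual_formN a b : form (- a) b = - form a b.
Proof. by rewrite -scaleN1r dual_formZ mulN1r. Qed.

Lemma dual_formNN a b : form (- a) (- b) = form a b.
Proof. by rewrite dual_formN dual_form_sym dual_formN opprK dual_form_sym. Qed.

Lemma dual_form_sum (I : finType) (F : I -> dual h) b :
  form (\sum_i F i) b = \sum_i form (F i) b.
Proof.
exact: (big_morph (form^~ b) (fun a a' => dual_formD a a' b) (dual_form0 b)).
Qed.

Lemma form_to_dualK : (forall t, (forall t', B (iota t) (iota t') = 0) -> t = 0) ->
  cancel (form_to_dual iota B) (form_to_dual iota B)^-1%VF.
Proof.
move=> nondeg t; apply: lker0_lfunK; apply/eqP; apply/vspaceP => u.
rewrite memv_ker memv0; apply/eqP/eqP => [u0|->]; last by rewrite linear0.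
by apply: nondeg => t'; rewrite -form_to_dualE u0 zero_lfunE.
Qed.

End DualForm.

Section RealRoots.
Variables (R : realType) (l : nat) (A : 'M[int]_l) (h : vectType R[i]).
Variables (g : lieAlgType R[i]) (iota : {linear h -> g}) (B : {symmetric g}).
Implicit Types (alpha : 'I_l -> dual h) (acheck : 'I_l -> h) (e f : 'I_l -> g).
Implicit Types (a b : dual h) (x y z : g) (n : 'I_l -> nat).
Local Notation form := (dual_form iota B).
Local Notation wts := (weights iota (@lie _ g)).

Lemma standard_form_opp alpha : standard_form iota B A alpha ->
  standard_form iota B A (fun i => - alpha i).
Proof. by case=> inv nd pos AE; split=> // *; rewrite ?dual_formNN. Qed.

(** The value of the lattice element [n] on the coroot of [i], kept as an integer so that its sign
    can be split into cases. *)
Definition cartan_pairing n i : int := \sum_j A i j * n j.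

Lemma lattice_acheck alpha acheck e f n i : KM_setting A iota alpha acheck e f ->
  (nat_lattice alpha n (acheck i) : R[i]) = (cartan_pairing n i)%:~R.
Proof.
case=> _ _ _ cart _; rewrite sum_lfunE raddf_sum; apply: eq_bigr => j _ /=.
by rewrite -pmulrn -scaler_nat scale_lfunE cart intrM -pmulrn mulrC.
Qed.

Lemma lattice_form_simple alpha n i : standard_form iota B A alpha ->
  form (nat_lattice alpha n) (alpha i) =
  (cartan_pairing n i)%:~R * (form (alpha i) (alpha i) / 2).
Proof.
case=> _ _ pos AE; rewrite dual_form_sum raddf_sum mulr_suml; apply: eq_bigr => j _ /=.
rewrite -pmulrn -scaler_nat dual_formZ intrM -pmulrn AE dual_form_sym.
have := lt0r_neq0 (pos i); move: (form (alpha i) (alpha i)) (form _ (alpha j)) => p q p0.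
by field; rewrite p0.
Qed.

Lemma simple_reflection_form alpha acheck e f n i :
  KM_setting A iota alpha acheck e f -> standard_form iota B A alpha ->
  form (simple_reflection alpha acheck i (nat_lattice alpha n))
       (simple_reflection alpha acheck i (nat_lattice alpha n)) =
  form (nat_lattice alpha n) (nat_lattice alpha n).
Proof.
move=> KM SF; rewrite /simple_reflection (lattice_acheck n i KM) -scaleNr.
set c : R[i] := (cartan_pairing n i)%:~R; set a := nat_lattice alpha n.
rewrite dual_formD dual_formZ dual_form_sym [form (alpha i) _]dual_form_sym.
rewrite !dual_formD !dual_formZ [form (alpha i) a]dual_form_sym.
by rewrite (lattice_form_simple n i SF) -/c; move: (form _ _) (form _ _) => p q; field.
Qed.

(* A positive root of positive norm pairs positively with some simple root in its
   support; unless it is simple, reflecting in the latter lowers its height. *)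
Lemma positive_real_root alpha acheck e f n :
  KM_setting A iota alpha acheck e f -> standard_form iota B A alpha ->
  wts (nat_lattice alpha n) -> 0 < form (nat_lattice alpha n) (nat_lattice alpha n) ->
  weyl_orbit alpha acheck (nat_lattice alpha n).
Proof.
move=> KM SF; move: {2}(\sum_i n i)%N (leqnn (\sum_i n i)) => N.
elim: N n => [|N IH] n nN Wn pos.
  move: pos; rewrite /nat_lattice /root_lattice big1 ?dual_form0 ?ltxx // => i _.
  by move: nN; rewrite leqn0 sum_nat_eq0 => /forallP/(_ i)/eqP ->.
have [i ni ci] : exists2 i, (0 < n i)%N & 0 < cartan_pairing n i.
  apply: contrapT => /forall2NP nP; move: pos; rewrite {1}/nat_lattice dual_form_sum.
  rewrite lt_def => /andP[/negP n0 le0]; apply: n0; rewrite eq_le le0 andbT.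
  apply: sumr_le0 => i _; rewrite -pmulrn -scaler_nat dual_formZ dual_form_sym.
  rewrite (lattice_form_simple n i SF).
  have [/negP|/negP] := nP i; first by rewrite lt0n negbK => /eqP ->; rewrite mul0r.
  rewrite -leNgt => ci; apply: mulr_ge0_le0 => //; apply: mulr_le0_ge0.
    by rewrite lerz0.
  by case: SF => _ _ /(_ i)/ltW ? _; apply: divr_ge0.
have rhoM := @lie_lie_module _ g; have rhoI := lie_integrable KM.
have Wr := weights_refl KM rhoM rhoI i Wn.
have [[j ji nj]|nj] := pselect (exists2 j, j != i & n j != 0%N); last first.
  rewrite (@nat_lattice_supp _ _ _ _ i) in Wn *; last first.
    by move=> j ji; apply/eqP/negPn/negP => n0; apply: nj; exists j.
  case: (n i) ni Wn => [//|[|k]] _ Wn; first exact: weyl_simple.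
  by case: Wn => x x0 /(simple_multiple_weight0 KM)/eqP; rewrite (negPf x0).
have [k ck] : exists k, cartan_pairing n i = k.+1%:Z.
  by exists (absz (cartan_pairing n i)).-1; lia.
have rE : simple_reflection alpha acheck i (nat_lattice alpha n) =
    nat_lattice alpha n - nat_lattice alpha (fun j => (j == i) * k.+1)%N.
  rewrite [X in _ - X](@nat_lattice_supp _ _ _ _ i) ?eqxx ?mul1n; last first.
    by move=> j' /negPf ->.
  by rewrite /simple_reflection (lattice_acheck n i KM) ck -pmulrn scaler_nat.
(* The reflection does not change the coefficient [n j] with [j != i], so the reflected root cannot
   be negative. *)
case: (Wr) => x x0 /(root_sign KM x0)[m [rm|rm]]; last first.
  move/eqP: (rm); rewrite rE -subr_eq0 opprK addrAC subr_eq0 -nat_latticeD.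
  move=> /eqP/(nat_lattice_inj KM)/(_ j); rewrite (negPf ji) mul0n => /eqP.
  by rewrite addn_eq0 (negPf nj).
rewrite -[nat_lattice alpha n](reflK KM i) rm; apply: weyl_refl; apply: IH.
- have nE : n =1 (fun j => m j + (j == i) * k.+1)%N.
    by apply: (nat_lattice_inj KM); rewrite nat_latticeD -rm rE subrK.
  have delta : (\sum_j (j == i) * k.+1 = k.+1)%N.
    by rewrite (bigD1 i) //= eqxx mul1n big1 ?addn0 // => j' /negPf ->.
  move: nN; rewrite (eq_bigr _ (fun j _ => nE j)) big_split /= delta addnS ltnS.
  exact/leq_trans/leq_addr.
- by rewrite -rm.
- by rewrite -rm (simple_reflection_form n i KM SF).
Qed.

(** Changing the sign of both root and coroot leaves the reflection unchanged. *)
Lemma weyl_orbit_swap alpha acheck e f b : KM_setting A iota alpha acheck e f ->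
  weyl_orbit (fun i => - alpha i) (fun i => - acheck i) b -> weyl_orbit alpha acheck b.
Proof.
move=> KM; elim=> [i|i b' _ IH].
  by apply: (weyl_orbit_opp KM); apply: weyl_simple.
have -> : simple_reflection (fun i => - alpha i) (fun i => - acheck i) i b' =
          simple_reflection alpha acheck i b'.
  by rewrite /simple_reflection scalerN opprK linearN /= scaleNr.
exact: weyl_refl.
Qed.

Lemma real_root_weyl_orbit alpha acheck e f b :
  KM_setting A iota alpha acheck e f -> standard_form iota B A alpha ->
  real_roots iota B b -> weyl_orbit alpha acheck b.
Proof.
move=> KM SF [[b0 [x [Wx /eqP x0]]] pos].
have Wb : wts b by exists x.
have [n [bE|bE]] := root_sign KM x0 Wx.
  by move: Wb pos; rewrite bE; apply: positive_real_root KM SF.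
apply: (weyl_orbit_swap KM); have latN : b = nat_lattice (fun i => - alpha i) n.
  by rewrite bE /nat_lattice /root_lattice -sumrN; apply: eq_bigr => i _; rewrite mulNrz.
move: Wb pos; rewrite latN.
exact: positive_real_root (KM_setting_swap KM) (standard_form_opp SF).
Qed.

(** The property transported along the Weyl orbit: g_b and g_-b are lines that [B] pairs
    nondegenerately. They move together, since [f_i^n] on one is matched by [e_i^n] on the other. *)
Definition root_pairing b := exists x y, [/\ root_space iota b x,
  root_space iota (- b) y, B x y != 0,
  forall z, root_space iota b z -> exists c, z = c *: x
& forall z, root_space iota (- b) z -> exists c, z = c *: y].

Lemma form_iter_ad z x y (n : nat) : (forall x y z, B [: x, y] z = B x [: y, z]) ->
  B (iter n (lie z) x) y = (-1) ^+ n * B x (iter n (lie z) y).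
Proof.
move=> inv; elim: n x y => [|n IH] x y; first by rewrite mul1r.
rewrite [in LHS]/= lieC linearNl /= inv IH -iterSr exprS.
by rewrite mulN1r mulNr.
Qed.

(** For [n >= 0], [f_i^n] maps g_b and [e_i^n] maps g_-b injectively to the reflected root spaces.
    Invariance gives [B (f_i^n x) (e_i^n y) = ± B x (f_i^n e_i^n y)], a nonzero multiple of
    [B x y]. *)
Lemma root_pairing_step alpha acheck e f b i (n : nat) :
  KM_setting A iota alpha acheck e f -> standard_form iota B A alpha ->
  (b (acheck i) : R[i]) = n%:R -> root_pairing b ->
  root_pairing (b - alpha i *+ n).
Proof.
move=> KM [inv _ _ _] bn [x [y [bx by_ xy ux uy]]].
have rhoM := @lie_lie_module _ g; have rhoI := lie_integrable KM.
have sl2 := simple_sl2_triple KM rhoM rhoI i.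
have ei : root_space iota (alpha i) (e i) by case: (KM) => -[_ _ he _ _] _ _ _ _ t.
have fi : root_space iota (- alpha i) (f i).
  by case: (KM) => -[_ _ _ hf _] _ _ _ _ t; rewrite hf opp_lfunE.
have Hpos a z : (a (acheck i) : R[i]) = n%:R -> root_space iota a z ->
    lie (iota (acheck i)) z = n%:R *: z by move=> an /(_ (acheck i)); rewrite an.
have Hneg a z : (a (acheck i) : R[i]) = - n%:R -> root_space iota a z ->
    lie (iota (acheck i)) z = - n%:R *: z by move=> an /(_ (acheck i)); rewrite an.
set b' := b - _; have b'n : (b' (acheck i) : R[i]) = - n%:R.
  rewrite /b' add_lfunE opp_lfunE -scaler_nat scale_lfunE (alpha_acheck KM) bn.
  rewrite -[_ *: 2]/(n%:R * 2 : R[i]); ring.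
have Nbn : ((- b) (acheck i) : R[i]) = - n%:R by rewrite opp_lfunE bn.
have Nb'n : ((- b') (acheck i) : R[i]) = n%:R by rewrite opp_lfunE b'n opprK.
have fb z : root_space iota b z -> root_space iota b' (iter n (lie (f i)) z).
  move=> bz; rewrite /b' -mulNrn.
  exact: (iter_act_weight rhoM _ fi bz).
have eb z : root_space iota b' z -> root_space iota b (iter n (lie (e i)) z).
  move=> bz; rewrite -[b](subrK (alpha i *+ n)) -/b'.
  exact: (iter_act_weight rhoM _ ei bz).
have eNb z : root_space iota (- b) z -> root_space iota (- b') (iter n (lie (e i)) z).
  move=> bz; rewrite /b' opprB addrC.
  exact: (iter_act_weight rhoM _ ei bz).
have fNb z : root_space iota (- b') z -> root_space iota (- b) (iter n (lie (f i)) z).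
  move=> bz; rewrite -[- b](addrK (alpha i *+ n)) -mulNrn.
  rewrite (_ : - b + _ = - b'); last by rewrite /b' opprB addrC.
  exact: (iter_act_weight rhoM _ fi bz).
have x0 : x != 0 by apply: contraNneq xy => ->; rewrite linear0l.
have y0 : y != 0 by apply: contraNneq xy => ->; rewrite linear0r.
have finj a z : (a (acheck i) : R[i]) = n%:R -> root_space iota a z ->
    iter n (lie (f i)) z = 0 -> z = 0.
  by move=> an az; apply: (sl2_iter_f_inj sl2); apply: Hpos az.
have einj a z : (a (acheck i) : R[i]) = - n%:R -> root_space iota a z ->
    iter n (lie (e i)) z = 0 -> z = 0.
  by move=> an az; apply: (sl2_iter_e_inj sl2); apply: Hneg az.
have [c cE] := uy _ (fNb _ (eNb _ by_)).
have [d dE] := ux _ (eb _ (fb _ bx)).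
have c0 : c != 0.
  apply: contraNneq y0 => c0; rewrite c0 scale0r in cE.
  by apply/eqP/(einj (- b)) => //; apply: (finj (- b')) => //; apply: eNb.
have d0 : d != 0.
  apply: contraNneq x0 => d0; rewrite d0 scale0r in dE.
  by apply/eqP/(finj b) => //; apply: (einj b') => //; apply: fb.
have sW a : submodule (root_space iota a) := weight_submodule iota (@lie _ g) a.
exists (iter n (lie (f i)) x), (iter n (lie (e i)) y); split.
- exact: fb.
- exact: eNb.
- by rewrite (form_iter_ad _ _ _ _ inv) cE linearZr_LR /= !mulf_neq0 // signr_eq0.
(* [e_i^n] embeds the reflected root space into the line of [x], so [z] is determined by its image
   [k x = (k / d) e_i^n f_i^n x]. *)
- move=> z b'z; have [k kE] := ux _ (eb _ b'z); exists (k / d); apply/subr0_eq.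
  apply: (einj b') => //; last by rewrite linearB linearZ /= dE kE scalerA divfK ?subrr.
  by apply: (submoduleB (sW _) b'z); apply: submoduleZ (sW _) (fb _ bx).
- move=> z b'z; have [k kE] := uy _ (fNb _ b'z); exists (k / c); apply/subr0_eq.
  apply: (finj (- b')) => //; last by rewrite linearB linearZ /= cE kE scalerA divfK ?subrr.
  by apply: (submoduleB (sW _) b'z); apply: submoduleZ (sW _) (eNb _ by_).
Qed.

Lemma root_pairing_simple alpha acheck e f i :
  KM_setting A iota alpha acheck e f -> standard_form iota B A alpha ->
  root_pairing (alpha i).
Proof.
move=> KM [inv nd _ _]; case: (KM) => -[_ ef he hf _] _ _ _ _.
exists (e i), (f i); split=> // [t|||].
- by rewrite hf opp_lfunE.
(* If [B (e i) (f i) = 0], invariance makes the coroot orthogonal to h, hence zero, although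
   [alpha i] takes the value 2 on it. *)
- apply/eqP => ef0; have /eqP := alpha_acheck KM i.
  rewrite (nd (acheck i)) ?linear0 1?eq_sym ?pnatr_eq0 // => t.
  have := ef i i; rewrite eqxx => <-.
  by rewrite inv lieC hf scaleNr opprK linearZr_LR /= ef0 mulr0.
- exact: simple_weight KM i.
- exact: simple_weight (KM_setting_swap KM) i.
Qed.

Lemma weyl_orbit_pairing alpha acheck e f b :
  KM_setting A iota alpha acheck e f -> standard_form iota B A alpha ->
  weyl_orbit alpha acheck b -> root_pairing b.
Proof.
move=> KM SF; elim=> [i|i {}b _ IH]; first exact: root_pairing_simple KM SF.
have [m bm] : exists m : int, (b (acheck i) : R[i]) = m%:~R.
  apply: (weights_int KM (@lie_lie_module _ g) (lie_integrable KM)).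
  case: IH => x [y [bx _ xy _ _]]; exists x => //.
  by apply: contraNneq xy => ->; rewrite linear0l.
rewrite /simple_reflection bm; case: m bm => n bn.
  by rewrite -pmulrn scaler_nat; apply: root_pairing_step KM SF bn IH.
(* A negative pairing becomes positive after the exchange of signs, which leaves the reflection
   unchanged. *)
rewrite NegzE intrN -pmulrn in bn *.
rewrite scaleNr -scalerN scaler_nat.
apply: root_pairing_step (KM_setting_swap KM) (standard_form_opp SF) _ IH.
by rewrite linearN /= bn opprK.
Qed.

(* [x, y] = B(x, y) t with b(t) = (b | b), where t is dual to b. *)
Lemma root_sl2 alpha acheck e f b x :
  KM_setting A iota alpha acheck e f -> standard_form iota B A alpha ->
  root_pairing b -> 0 < form b b -> root_space iota b x -> x != 0 ->
  exists y t, [/\ root_space iota (- b) y, [: x, y] = iota t & (b t : R[i]) = 2].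
Proof.
move=> KM [inv nd _ _] [x1 [y [_ by_ x1y ux _]]] pos bx x0.
have xy : B x y != 0.
  have [c xE] := ux x bx; rewrite xE in x0 *.
  rewrite linearZl_LR /= mulf_neq0 //.
  by apply: contraNneq x0 => ->; rewrite scale0r.
have [t tE] : exists t, [: x, y] = iota t.
  apply: (zero_weight KM); rewrite -(addNr b).
  exact: (act_weight (@lie_lie_module _ g) bx by_).
have tb : form_to_dual iota B t = B x y *: b.
  apply/lfunP => t'; rewrite form_to_dualE -tE inv lieC by_ opp_lfunE scaleNr opprK.
  by rewrite linearZr_LR scale_lfunE; apply: mulrC.
have bt : (b t : R[i]) = B x y * form b b.
  apply: (mulfI xy); transitivity ((B x y *: b) t : R[i]).
    by rewrite scale_lfunE.
  rewrite -tb form_to_dualE.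
  transitivity (form (B x y *: b) (B x y *: b)).
    by rewrite /dual_form -tb form_to_dualK.
  by rewrite dual_formZ dual_form_sym dual_formZ.
have bt0 : (b t : R[i]) != 0 by rewrite bt mulf_neq0 // lt0r_neq0.
exists ((2 / (b t : R[i])) *: y), ((2 / (b t : R[i])) *: t); split.
- exact: submoduleZ (weight_submodule iota (@lie _ g) _) by_.
- by rewrite linearZr_LR /= tE linearZ.
- by rewrite linearZ /= -[LHS]/(2 / (b t : R[i]) * (b t : R[i])) divfK.
Qed.

End RealRoots.

(** * Highest weight modules *)

Section HighestWeight.
Variables (R : realType) (l : nat) (A : 'M[int]_l) (h : vectType R[i]).
Variables (g : lieAlgType R[i]) (iota : {linear h -> g}).
Variables (alpha : 'I_l -> dual h) (acheck : 'I_l -> h) (e f : 'I_l -> g).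
Hypothesis KM : KM_setting A iota alpha acheck e f.
Variables (V : lmodType R[i]) (rho : {bilinear g -> V -> V}).
Hypotheses (rhoM : lie_module rho) (rhoirr : irreducible_module rho).
Variables (lambda : dual h) (v : V).
Hypotheses (v0 : v != 0) (ev : forall i, rho (e i) v = 0).
Hypothesis vlambda : weight_space iota rho lambda v.
Local Notation wt := (weight_space iota rho).

Lemma normalizer_generates (M : set V) : submodule M ->
  (forall t u, M u -> M (rho (iota t) u)) -> (forall i u, M u -> M (rho (e i) u)) ->
  (forall i u, M u -> M (rho (f i) u)) -> forall x u, M u -> M (rho x u).
Proof.
case: KM => _ gen _ _ _ sM Mi Me Mf x.
apply: (gen [set x | forall u, M u -> M (rho x u)]) => //=.
- split=> [u _|c y z My Mz u Mu] /=; first by rewrite linear0l; case: sM.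
  by rewrite linearPl; case: sM => _; apply; [apply: My | apply: Mz].
- move=> y z My Mz u Mu; rewrite rhoM.
  by apply: (submoduleB sM); [apply/My/Mz | apply/Mz/My].
Qed.

Definition hw_monomial s := foldr (fun j => rho (f j)) v s.

Lemma hw_monomial_weight s :
  wt (lambda - nat_lattice alpha (fun j => count_mem j s)) (hw_monomial s).
Proof.
rewrite /nat_lattice -lattice_seq; elim: s => [|j s IH].
  by rewrite big_nil subr0.
rewrite big_cons [alpha j + _]addrC opprD addrA.
case: (KM) => -[_ _ _ hf _] _ _ _ _.
apply: (act_weight rhoM _ IH) => t.
by rewrite hf opp_lfunE.
Qed.

(** By irreducibility it is enough that the span is stable under the generators: [e_i] moves inward
    past each [f_j], leaving terms from h, until it kills [v]. *)
Lemma hw_span u : lspan (range hw_monomial) u.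
Proof.
have sM := lspan_submodule (range hw_monomial); set M := lspan _ in sM *.
case: (KM) => -[_ ef _ _ _] _ _ _ _.
have Mm s : M (hw_monomial s) by apply: sub_lspan; exists s.
have Mi t w : M w -> M (rho (iota t) w).
  apply: lspan_linear (sM) _ w => _ [s _ <-] /=.
  by rewrite hw_monomial_weight; apply: (submoduleZ _ sM).
have Mf i w : M w -> M (rho (f i) w).
  by apply: lspan_linear (sM) _ w => _ [s _ <-]; apply: (Mm (i :: s)).
have Me i w : M w -> M (rho (e i) w).
  apply: lspan_linear (sM) _ w => _ [s _ <-] /=.
  elim: s => [|j s IH] /=; first by rewrite ev; case: sM.
  rewrite -[rho (e i) _](subrK (rho (f j) (rho (e i) (hw_monomial s)))) -rhoM ef.
  apply: (submoduleD sM); last exact: Mf.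
  by case: eqP => _; [apply: Mi | rewrite linear0l; case: sM].
have Mstab := normalizer_generates sM Mi Me Mf.
case: rhoirr => _ /(_ M (submoduleP sM) Mstab)[M0|-> //].
by have := Mm nil; rewrite M0 => /eqP; rewrite (negPf v0).
Qed.

Lemma hw_lspan_weight a u : wt a u -> lspan (range hw_monomial `&` wt a) u.
Proof.
apply: lspan_weight (hw_span u) => _ [s _ <-].
by eexists; apply: hw_monomial_weight.
Qed.

Lemma hw_weight a : weights iota rho a -> exists n, a = lambda - nat_lattice alpha n.
Proof.
case=> u u0 /hw_lspan_weight/(lspan_neq0 u0)[w [[s _ <-] aw] w0].
eexists; exact: weight_unique w0 aw (hw_monomial_weight s).
Qed.

Lemma hw_line u : wt lambda u -> exists c, u = c *: v.
Proof.
move=> /hw_lspan_weight Lu; apply: lspan_singleton.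
apply: lspan_min Lu => [|_ [[s _ <-] Ws]]; first exact: lspan_submodule.
have [->|s0] := eqVneq (hw_monomial s) 0; first exact: lspan_zero.
have /eqP := weight_unique s0 Ws (hw_monomial_weight s).
rewrite -subr_eq0 opprB addrC subrK -(nat_lattice0 alpha) => /eqP/(nat_lattice_inj KM).
case: s {Ws s0} => [_|i s /(_ i)]; first exact: sub_lspan.
by rewrite /= eqxx.
Qed.

Lemma hw_string a b : integrable_module e f rho -> weyl_orbit alpha acheck b ->
  weights iota rho a -> exists N, forall k, (N <= k)%N -> ~ weights iota rho (a + b *+ k).
Proof.
move=> rhoI; apply: (weyl_string KM) => a' i.
- exact: (weights_int KM rhoM rhoI).
- exact: (weights_refl KM rhoM rhoI).
- move=> /hw_weight[n ->]; left; exists (n i).+1 => k nk /hw_weight[m].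
  have -> : alpha i *+ k = nat_lattice alpha (fun j => (j == i) * k)%N.
    by rewrite (@nat_lattice_supp _ _ _ _ i) ?eqxx ?mul1n // => j' /negPf ->.
  set d := nat_lattice alpha (fun j => _ * _)%N; rewrite -addrA => /addrI E.
  have : d + nat_lattice alpha m = nat_lattice alpha n.
    by rewrite -[nat_lattice alpha m]opprK -E opprD opprK addrCA subrr addr0.
  rewrite -nat_latticeD => /(nat_lattice_inj KM)/(_ i).
  rewrite eqxx; lia.
Qed.

Lemma hw_nilpotent b x : integrable_module e f rho -> weyl_orbit alpha acheck b ->
  root_space iota b x -> locally_nilpotent (rho x).
Proof.
move=> rhoI Wb; apply: (weyl_nilpotent rhoM) => [u|a].
  apply: lspan_min (hw_span u) => [|_ [s _ <-]]; first exact: lspan_submodule.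
  by apply: sub_lspan; eexists; apply: hw_monomial_weight.
exact: hw_string.
Qed.

End HighestWeight.

(** * The commutant *)

Section Commutant.
Variables (R : realType) (l : nat) (A : 'M[int]_l) (h : vectType R[i]).
Variables (g : lieAlgType R[i]) (iota : {linear h -> g}).
Variables (alpha : 'I_l -> dual h) (acheck : 'I_l -> h) (e f : 'I_l -> g).
Variable B : {symmetric g}.
Hypothesis KM : KM_setting A iota alpha acheck e f.
Hypothesis SF : standard_form iota B A alpha.
Variables (V : lmodType R[i]) (rho : {bilinear g -> V -> V}).
Hypothesis rhoM : lie_module rho.
Hypothesis rho_nil : forall b x, weyl_orbit alpha acheck b -> root_space iota b x ->
  locally_nilpotent (rho x).
Hypothesis rho_span : forall v, lspan [set w | exists a, weight_space iota rho a w] v.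
Variable F : {linear V -> V}.
Implicit Types (a b : dual h) (x y : g).
Local Notation form := (dual_form iota B).

Definition commutant : set g := [set x | forall v, rho x (F v) = F (rho x v)].
Hypothesis F_iota : range iota `<=` commutant.

Lemma commutant_submodule : submodule commutant.
Proof.
split=> [v|c x y Fx Fy v]; first by rewrite !linear0l linear0.
by rewrite !linearPl Fx Fy linearP.
Qed.

Lemma commutant_lie x y : commutant x -> commutant y -> commutant [: x, y].
Proof. by move=> Fx Fy v; rewrite !rhoM Fx Fy Fx Fy linearB. Qed.

(** One nonzero root vector suffices: it is completed to an sl2-triple whose Cartan element lies in
    h, [sl2_commutant] gives the opposite vector, and both root spaces are lines. *)
Lemma commutant_root b x : weyl_orbit alpha acheck b -> 0 < form b b ->
  root_space iota b x -> x != 0 -> commutant x ->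
  root_space iota b `<=` commutant /\ root_space iota (- b) `<=` commutant.
Proof.
move=> Wb pos bx x0 Fx.
have rp := weyl_orbit_pairing KM SF Wb.
have [y [t [by_ xy bt]]] := root_sl2 KM SF rp pos bx x0.
have [x1 [y1 [_ _ _ ux uy]]] := rp.
have tx : [: iota t, x] = 2 *: x by rewrite bx bt.
have sl2 : sl2_triple (rho x) (rho y) (rho (iota t)).
  apply: (module_sl2_triple rhoM) => //; first by rewrite by_ opp_lfunE bt.
    exact: rho_nil Wb bx.
  exact: rho_nil (weyl_orbit_opp KM Wb) by_.
have y0 : y != 0.
  apply: contraNneq x0 => y0; have /eqP := tx.
  by rewrite -xy y0 linear0 linear0l eq_sym scaler_eq0 pnatr_eq0.
have Fy : commutant y.
  move=> v; apply/eqP; rewrite -subr_eq0; apply/eqP.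
  pose D : {linear V -> V} := (rho y \o F) \- (F \o rho y).
  apply: (lspan_linear (phi := D) (submodule0 V) _ (rho_span v)) => w [a Ww] /=.
  have Ft : commutant (iota t) by apply: F_iota; exists t.
  have fF := sl2_commutant sl2 (fun u => esym (Fx u)) (fun u => esym (Ft u)) (Ww t).
  by rewrite -fF subrr.
have sC := commutant_submodule; split=> z bz.
  have [c xE] := ux _ bx; have [d ->] := ux _ bz.
  have c0 : c != 0 by apply: contraNneq x0 => c0; rewrite xE c0 scale0r.
  by rewrite -[x1](scalerK c0) -xE scalerA; exact: (submoduleZ _ sC Fx).
have [c yE] := uy _ by_; have [d ->] := uy _ bz.
have c0 : c != 0 by apply: contraNneq y0 => c0; rewrite yE c0 scale0r.
by rewrite -[y1](scalerK c0) -yE scalerA; exact: (submoduleZ _ sC Fy).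
Qed.

(* If [x, y] = 0 then x is a highest weight vector, of weight n, for the sl2-triple
   (y, z, t) of b; a root vector w of weight a + b has weight n + 2 and [z, w] is a
   multiple of x, so that it is killed by z^(n+2), contradicting sl2-theory. *)
Lemma real_root_bracket a b x y w :
  weyl_orbit alpha acheck a -> weyl_orbit alpha acheck b -> 0 < form b b ->
  root_space iota a x -> x != 0 -> root_space iota b y -> y != 0 ->
  root_space iota (a + b) w -> w != 0 -> [: y, x] != 0.
Proof.
move=> Wa Wb pos ax x0 by_ y0 abw w0; apply/eqP => yx.
have lieM := @lie_lie_module _ g.
have rp := weyl_orbit_pairing KM SF Wb.
have [z [t [bz yz bt]]] := root_sl2 KM SF rp pos by_ y0.
have sl2 : sl2_triple (lie y) (lie z) (lie (iota t)).
  apply: (module_sl2_triple lieM) => //.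
  - by rewrite by_ bt.
  - by rewrite bz opp_lfunE bt.
  - exact: lie_weyl_nilpotent KM Wb by_.
  - exact: lie_weyl_nilpotent KM (weyl_orbit_opp KM Wb) bz.
have [n an zx] := sl2_highest_weight sl2 x0 (ax t) yx.
have [x1 [_ [_ _ _ ux _]]] := weyl_orbit_pairing KM SF Wa.
have azw : root_space iota a [: z, w].
  by rewrite -[a](addrK b); apply: (act_weight lieM bz abw).
have [d xE] := ux _ ax; have [c zw] := ux _ azw.
have d0 : d != 0 by apply: contraNneq x0 => d0; rewrite xE d0 scale0r.
have zwx : [: z, w] = (c / d) *: x by rewrite xE scalerA divfK.
move/eqP: w0; apply; apply: (sl2_iter_f_inj (n := n.+2) sl2).
  by rewrite /= abw add_lfunE an bt -(addn2 n) natrD.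
rewrite iterSr [X in iter _ _ X]zwx.
by rewrite (GRing.scalable_linear (linear_iter (lie z) n.+1)) zx; apply: scaler0.
Qed.

Definition commutant_roots : set (dual h) := [set b | real_roots iota B b /\
  root_space iota b `<=` commutant /\ root_space iota (- b) `<=` commutant].

Lemma commutant_roots_opp b :
  Defs.roots iota b -> commutant_roots (- b) -> commutant_roots b.
Proof.
move=> rb [[_ pos] [Fb Fb']]; rewrite opprK in Fb'.
by split=> //; split=> //; rewrite -dual_formNN.
Qed.

(** The bracket is formed only for [a + b]; the opposite root space is then supplied by
    [commutant_root]. *)
Lemma commutant_roots_closed : real_closed iota B commutant_roots.
Proof.
split=> [b []//|a b [ra [Fa _]] [rb [Fb _]] rab].
have [Wa Wb Wab] : [/\ weyl_orbit alpha acheck a, weyl_orbit alpha acheck b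
    & weyl_orbit alpha acheck (a + b)] by split; apply: real_root_weyl_orbit KM SF _.
have [[[_ [x [ax /eqP x0]]] _] [[_ [y [by_ /eqP y0]]] posb]] := (ra, rb).
have [[_ [w [abw /eqP w0]]] posab] := rab.
have yx := real_root_bracket Wa Wb posb ax x0 by_ y0 abw w0.
split=> //; apply: (commutant_root Wab posab _ yx).
  exact: (act_weight (@lie_lie_module _ g) by_ ax).
by apply: commutant_lie; [apply: Fb | apply: Fa].
Qed.

End Commutant.

Theorem theorem3p2 (R : realType)
    (l : nat) (A : 'M[int]_l)
    (h : vectType R[i]) (alpha : 'I_l -> dual h) (acheck : 'I_l -> h)
    (g : lieAlgType R[i]) (iota : {linear h -> g}) (e f : 'I_l -> g)
    (B : {symmetric g}) (s : set g)
    (V : lmodType R[i]) (rho : {bilinear g -> V -> V}) (lambda : dual h) :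
  generalized_Cartan_matrix A ->
  symmetrizable R A ->
  realization A alpha acheck ->
  KacMoody_algebra A alpha acheck iota e f ->
  standard_form iota B A alpha ->
  regular_subalgebra iota s ->
  range iota `<=` s ->
  lie_module rho ->
  irreducible_module rho ->
  integrable_module e f rho ->
  highest_weight_module iota e rho lambda ->
  let T := roots_of iota s in
  range alpha `<=` real_closure iota B (T `|` -%R @` T) ->
  End_invariants rho s = scalar_endomorphisms V.
Proof.
move=> [diag _ _] _ [_ fr _ cart] KMg SF _ hs rhoM rhoirr rhoI [_ [v [v0 ev vl _]]] T Tcl.
have KM : KM_setting A iota alpha acheck e f.
  split=> //; first by case: KMg.
    by move=> W; apply: KacMoody_generated KMg.
  exact: free_lattice_free.
have rho_nil := hw_nilpotent KM rhoM rhoirr v0 ev vl rhoI.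
have rho_span u : lspan [set w | exists a, weight_space iota rho a w] u.
  apply: lspan_min (hw_span KM rhoM rhoirr v0 ev vl u); first exact: lspan_submodule.
  by move=> _ [m _ <-]; apply: sub_lspan; eexists; exact: (hw_monomial_weight KM rhoM vl).
apply/seteqP; split=> [F Fs|F [c Fc] x _ u]; last first.
  by rewrite /End_act !Fc linearZr_LR subrr.
have FC : s `<=` commutant rho F by move=> x sx u; apply/subr0_eq/Fs.
have Fi : range iota `<=` commutant rho F by move=> x /hs/FC.
have sC := commutant_submodule rho F.
have clos := commutant_roots_closed KM SF rhoM rho_nil rho_span Fi.
have TC : (T `|` -%R @` T) `&` real_roots iota B `<=` commutant_roots iota B rho F.
  have TC b : T b -> 0 < dual_form iota B b b -> commutant_roots iota B rho F b.
    move=> [rb [x [[sx bx] /eqP x0]]] pos; split; first exact: (conj rb pos).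
    have Wb := real_root_weyl_orbit KM SF (conj rb pos).
    exact: (commutant_root KM SF rhoM rho_nil rho_span Fi Wb pos bx x0 (FC _ sx)).
  (* For a root [- b'] with [b'] in [T], the claim for [b'] is transferred by the symmetry of
     [commutant_roots]. *)
  move=> b [[Tb|[b' Tb' <-]] [rb pos]]; first exact: TC.
  rewrite dual_formNN in pos; apply: commutant_roots_opp => //.
  by rewrite opprK; apply: TC.
have simple i : commutant_roots iota B rho F (alpha i).
  by apply: (smallest_sub clos TC); apply: Tcl; exists i.
have Fe i : commutant rho F (e i).
  have [_ [H _]] := simple i; apply: H.
  by case: (KM) => -[_ _ he _ _] _ _ _ _ t.
have Ff i : commutant rho F (f i).
  have [_ [_ H]] := simple i; apply: H => t.
  by case: (KM) => -[_ _ _ hf _] _ _ _ _; rewrite hf opp_lfunE.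
have Fg x : commutant rho F x.
  case: KM => _ gen _ _ _; apply: gen => // [y z|t]; first exact: commutant_lie.
  by apply: Fi; exists t.
have [c Fv] : exists c, F v = c *: v.
  apply: (hw_line KM rhoM rhoirr v0 ev vl) => t.
  by rewrite Fg vl linearZ.
(* The kernel of [F - c] is a submodule containing [v], hence all of V. *)
exists c; pose D : {linear V -> V} := F \- ( *:%R c).
have sD := submodule_preim D (@submodule0 _ V).
have Dstab x u : (D @^-1` [set 0]) u -> (D @^-1` [set 0]) (rho x u).
  rewrite /preimage /= => /subr0_eq Fu.
  by rewrite -Fg Fu linearZ /= subrr.
have Dv : (D @^-1` [set 0]) v by rewrite /preimage /= Fv subrr.
case: rhoirr => _ /(_ _ (submoduleP sD) Dstab)[D0|DT].
  by move: Dv; rewrite D0 => /eqP; rewrite (negPf v0).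
move=> u; have : (D @^-1` [set 0]) u by rewrite DT.
by rewrite /preimage /= => /subr0_eq.
Qed.
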